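(* Let $\alpha>0$ and let $I\subset\mathbb R$ be an interval with $|I|=1$ and $0\in I$. Then there is a constant $C>0$, depending only on $\alpha$, such that whenever $\phi:D_5\to\mathbb C$ is an analytic function with $|\phi(0)|\ge1$ and $E\subset I$ is a subset with $c_{h_\alpha}(E)>0$, $$\sup_{x\in I}|\phi(x)|\le M^9\exp\Big\{\frac{C(\log M)^2\big(\log(\frac{\log M}{\log2}+e)\big)^{-\frac{2\alpha}3}}{c^2_{h_\alpha}(E)}\Big\}\sup_{x\in E}|\phi(x)|,$$ where $M:=\sup_{z\in D_4}|\phi(z)|$.
   Context: $D_k=\{z\in\mathbb C:|z|\le k\}$ for $k>0$; $|I|$ is the length of $I$; $c^2_{h_\alpha}(E)=(c_{h_\alpha}(E))^2$. A gauge function is a strictly increasing continuous $f:(0,\infty)\to[0,\infty)$ with $\lim_{t\to0^+}f(t)=0$. For a gauge function $f$, the $f$-Hausdorff content is $c_f(E)=\inf\{\sum_{j\ge1} f(d(B_j)):E\subset\bigcup_{j\ge1} B_j\}$, where the $B_j$ are open balls with diameter $d(B_j)$ (in $\mathbb R$ for subsets of $\mathbb R$). $h_\alpha(t)=(\log\frac1t)^{-1/2}(\log\log\frac1t)^{-\alpha}$ for $0<t\le e^{-3}$, understood as a gauge function on $(0,\infty)$ via a fixed extension with $h_\alpha(t)\sim1$ as $t\to+\infty$. *)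

(* Defs.v *)
From Stdlib Require Import Reals.
From Coquelicot Require Import Coquelicot.
Open Scope R_scope.

(* Coquelicot's [is_series] is convergence in the topology of the module, so
   [is_pseries a (w - z) (phi w)] says phi w = sum_k a_k (w - z)^k in C.
   As [locally z] is the filter of full neighbourhoods in C, a function that is
   analytic on a closed set is analytic on an open set containing it. *)
Definition analytic_on (A : C -> Prop) (phi : C -> C) : Prop :=
  forall z : C, A z ->
    exists a : nat -> C,
      locally z (fun w : C =>
        @is_pseries C_AbsRing C_NormedModule a (w - z)%C (phi w)).

Definition disk (k : R) (z : C) : Prop := Cmod z <= k.

(* Equal to the supremum of g over A when A is nonempty and g is bounded above
   on A; [real] sends infinite values to 0. *)
Definition sup_on {T : Type} (A : T -> Prop) (g : T -> R) : R :=
  real (Lub_Rbar (fun y => exists x, A x /\ y = g x)).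

Definition is_interval (I : R -> Prop) : Prop :=
  forall x y z, I x -> I y -> x <= z <= y -> I z.

Definition interval_length (I : R -> Prop) : Rbar :=
  Rbar_minus (Lub_Rbar I) (Glb_Rbar I).

(* Only the values on (0, +oo) are meaningful. *)
Definition gauge_function (f : R -> R) : Prop :=
  (forall t, 0 < t -> 0 <= f t) /\
  (forall s t, 0 < s -> s < t -> f s < f t) /\
  (forall t, 0 < t -> continuous f t) /\
  filterlim f (at_right 0) (locally 0).

(* Covers whose series diverges have infinite cost and do not affect the
   infimum.  Finite covers need no separate treatment: for a gauge function they
   can be completed by balls of arbitrarily small total cost. *)
Definition hausdorff_content (f : R -> R) (E : R -> Prop) : Rbar :=
  Glb_Rbar (fun s => exists c r : nat -> R,
    (forall j, 0 < r j) /\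
    (forall x, E x -> exists j, ball (c j) (r j) x) /\
    is_series (fun j => f (2 * r j)) s).

Definition h_formula (alpha t : R) : R :=
  Rpower (ln (1 / t)) (- (1 / 2)) * Rpower (ln (ln (1 / t))) (- alpha).

(* [h] is one of the admissible extensions of the formula from (0, e^(-3)] to
   (0, +oo); "h(t) ~ 1 as t -> +oo" is asymptotic equivalence. *)
Definition is_h (alpha : R) (h : R -> R) : Prop :=
  gauge_function h /\
  (forall t, 0 < t <= exp (-3) -> h t = h_formula alpha t) /\
  is_lim h p_infty 1.

(* Main.v *)
(** Zeros of [phi] are never counted; [phi] is interpolated at points of [E].
    Let [N] be comparable to [log M / log 2] and let [L] be the Lagrange
    interpolant of [phi] at [N] nodes of [E], with node polynomial [omega].  The
    maximum principle for [(phi - L) / omega] on [|w| <= 4], where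
    [|omega| >= 3^N] on the boundary, gives
    [|phi 0| <= M / 3^N + 2 N (5^N / d) sup_E |phi|], where [d] bounds from below
    the distance products [prod_(i <> j) |x_j - x_i|] of the nodes.  As
    [|phi 0| >= 1], this bounds [sup_E |phi|] from below.

    The nodes nearly maximize the Vandermonde product over [E], so [d] is half of
    any [d0] that every monic polynomial of degree less than [N] with real roots
    reaches in modulus on [E].  Such a [d0] comes from Cartan's covering lemma with
    radii [r_k] such that [h (4 r_k) <= k c / (2 N)], [c] being the content of
    [E]: the exceptional balls cost at most [c / 2], so some point of [E] has
    fewer than [k] roots within [r_k] for every [k], and [d0 = prod r_k] works.

    For [M <= 2] the factor [M^9] must suffice near [M = 1], and Schwarz-Pick
    gives this. *)
Require Import Defs.
From Stdlib Require Import Reals Lra Lia List Permutation.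
From Stdlib Require Import Classical ClassicalEpsilon.
From Coquelicot Require Import Coquelicot.
Open Scope R_scope.

(** * Finite Taylor expansions and the maximum principle *)

Lemma Cmod_sub_comm (z w : C) : Cmod (z - w) = Cmod (w - z).
Proof. rewrite <- Cmod_opp. f_equal. ring. Qed.

Lemma Cmod_triangle_rev (z w : C) : Cmod z - Cmod w <= Cmod (z - w).
Proof.
  assert (H := Cmod_triangle (z - w) w).
  replace (z - w + w)%C with z in H by ring. lra.
Qed.

Lemma Cmod_le_abs (x y : R) : Cmod (x, y) <= Rabs x + Rabs y.
Proof.
  replace ((x, y) : C) with (RtoC x + Ci * RtoC y)%C
    by (unfold RtoC, Ci, Cplus, Cmult; simpl; f_equal; ring).
  apply Rle_trans with (1 := Cmod_triangle _ _).
  rewrite Cmod_mult, Cmod_Ci, !Cmod_R. lra.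
Qed.

Lemma list_argmax {A : Type} (g : A -> R) (l : list A) :
  l <> nil -> exists a, In a l /\ forall b, In b l -> g b <= g a.
Proof.
  induction l as [|x [|y l] IH]; intros Hl; [congruence| |].
  - exists x. split; [now left|]. intros b [->|[]]. lra.
  - destruct IH as [a [Ha Hmax]]; [congruence|].
    destruct (Rle_dec (g x) (g a)) as [H|H].
    + exists a. split; [now right|]. intros b [->|Hb]; auto.
    + exists x. split; [now left|]. intros b [->|Hb]; [lra|].
      specialize (Hmax b Hb). lra.
Qed.

(** By compactness of a square containing the disk. If [u] had no maximum, every point of the disk
    would have a neighbourhood on which [u] stays below some [u v] with [v] in the disk; the largest
    of finitely many such values would then lie strictly below one of them. *)
Lemma usc_attains_max_on_disk (k : R) (u : C -> R) :
  0 <= k ->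
  (forall z, disk k z -> forall eps, 0 < eps ->
     exists d, 0 < d /\ forall w, Cmod (w - z) < d -> u w < u z + eps) ->
  exists z, disk k z /\ forall w, disk k w -> u w <= u z.
Proof.
  intros Hk Husc. apply NNPP. intros Hno.
  assert (Hlarger : forall z, disk k z -> exists w, disk k w /\ u z < u w).
  { intros z Hz. apply NNPP. intros H. apply Hno. exists z. split; [easy|].
    intros w Hw. apply Rnot_lt_le. intros Hlt. apply H. now exists w. }
  assert (Hcover : forall t : Compactness.Tn 2 R, exists p : posreal * C,
    disk k (snd p) /\
    forall w : C, disk k w -> close_n 2 (fst p) (fst w, (snd w, tt)) t ->
      u w < u (snd p)).
  { intros [x [y []]].
    assert (Hclose : forall (d : R) (w : C),
      close_n 2 (d / 2) (fst w, (snd w, tt)) (x, (y, tt)) ->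
      Cmod (w - (x, y)) < d).
    { intros d [wx wy]. cbn. intros (H1 & H2 & _).
      apply Rle_lt_trans with (Rabs (wx - x) + Rabs (wy - y));
        [apply Cmod_le_abs | lra]. }
    destruct (Rle_dec (Cmod (x, y)) k) as [Hz|Hz].
    - destruct (Hlarger _ Hz) as [v [Hv Huv]].
      destruct (Husc _ Hz (u v - u (x, y))) as [d [Hd H]]; [lra|].
      exists (pos_div_2 (mkposreal d Hd), v). split; [exact Hv|].
      intros w _ Hw. apply (Hclose d), H in Hw. simpl. lra.
    (* Off the disk the neighbourhood is taken so small that it misses the disk; the point 0
       attached to it is arbitrary. *)
    - assert (Hd : 0 < Cmod (x, y) - k) by lra.
      exists (pos_div_2 (mkposreal _ Hd), RtoC 0). split.
      + unfold disk. simpl. rewrite Cmod_0. lra.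
      + intros w Hwk Hw. apply (Hclose (Cmod (x, y) - k)) in Hw.
        rewrite Cmod_sub_comm in Hw.
        assert (H := Cmod_triangle_rev (x, y) w). unfold disk in Hwk. lra. }
  destruct (choice _ Hcover) as [p Hp].
  apply (compactness_list 2 (-k, (-k, tt)) (k, (k, tt)) (fun t => fst (p t))).
  intros [l Hl].
  assert (Hin : forall w, disk k w -> exists t, In t l /\ u w < u (snd (p t))).
  { intros w Hw.
    assert (H := Rmax_Cmod w). unfold disk in Hw.
    destruct (Hl (fst w, (snd w, tt))) as [t (Ht & _ & Hcl)].
    - assert (H1 := Rmax_l (Rabs (fst w)) (Rabs (snd w))).
      assert (H2 := Rmax_r (Rabs (fst w)) (Rabs (snd w))).
      cbn. split; [|split; [|easy]]; apply Rabs_le_between; lra.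
    - exists t. split; [easy|]. now apply Hp. }
  destruct (list_argmax (fun t => u (snd (p t))) l) as [t [Ht Hmax]].
  - intros ->. destruct (Hin (RtoC 0)) as [t [[] _]].
    unfold disk. rewrite Cmod_0. lra.
  - destruct (Hin (snd (p t))) as [t' [Ht' Hlt]]; [apply Hp|].
    specialize (Hmax _ Ht'). simpl in Hmax. lra.
Qed.

(* [f w = a_0 + ... + a_(n-1) (w - z)^(n-1) + O((w - z)^n)], by iterated difference
   quotients, so that closure under products and inverses is an induction. *)
Fixpoint taylor_order (n : nat) (z : C) (f : C -> C) : Prop :=
  match n with
  | O => exists B d : R, 0 < d /\ forall w, Cmod (w - z) < d -> Cmod (f w) <= B
  | S m => exists g : C -> C, taylor_order m z g /\
      exists d, 0 < d /\
        forall w, Cmod (w - z) < d -> f w = (f z + (w - z) * g w)%C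
  end.

Lemma taylor_order_S (n : nat) (z : C) (f : C -> C) :
  taylor_order (S n) z f -> taylor_order n z f.
Proof.
  revert f. induction n as [|n IH]; intros f [g [Hg [d [Hd Hf]]]].
  - destruct Hg as [B [e [He HB]]].
    exists (Cmod (f z) + d * B), (Rmin d e).
    split; [now apply Rmin_pos|]. intros w Hw.
    assert (H1 : Cmod (w - z) < d) by (apply Rlt_le_trans with (1 := Hw), Rmin_l).
    assert (H2 : Cmod (w - z) < e) by (apply Rlt_le_trans with (1 := Hw), Rmin_r).
    rewrite (Hf w H1).
    apply Rle_trans with (1 := Cmod_triangle _ _). rewrite Cmod_mult.
    apply Rplus_le_compat_l, Rmult_le_compat; try apply Cmod_ge_0; auto. lra.
  - exists g. split; [now apply IH|]. now exists d.
Qed.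

Lemma taylor_order_le (m n : nat) (z : C) (f : C -> C) :
  (m <= n)%nat -> taylor_order n z f -> taylor_order m z f.
Proof. induction 1; auto. intros H1. now apply IHle, taylor_order_S. Qed.

Lemma taylor_order_ext (n : nat) (z : C) (f g : C -> C) (d : R) :
  0 < d -> (forall w, Cmod (w - z) < d -> f w = g w) ->
  taylor_order n z f -> taylor_order n z g.
Proof.
  intros Hd Hfg. destruct n as [|n].
  - intros [B [e [He HB]]]. exists B, (Rmin d e).
    split; [now apply Rmin_pos|]. intros w Hw. rewrite <- Hfg.
    + apply HB, Rlt_le_trans with (1 := Hw), Rmin_r.
    + apply Rlt_le_trans with (1 := Hw), Rmin_l.
  - intros [k [Hk [e [He H]]]]. exists k. split; [easy|].
    exists (Rmin d e). split; [now apply Rmin_pos|]. intros w Hw.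
    rewrite <- !Hfg.
    + apply H, Rlt_le_trans with (1 := Hw), Rmin_r.
    + replace (z - z)%C with (RtoC 0) by ring. now rewrite Cmod_0.
    + apply Rlt_le_trans with (1 := Hw), Rmin_l.
Qed.

Lemma taylor_order_const (n : nat) (z c : C) : taylor_order n z (fun _ => c).
Proof.
  revert c. induction n as [|n IH]; intros c.
  - exists (Cmod c), 1. split; [lra|]. intros; lra.
  - exists (fun _ => RtoC 0). split; [apply IH|].
    exists 1. split; [lra|]. intros; ring.
Qed.

Lemma taylor_order_id (n : nat) (z : C) : taylor_order n z (fun w => w).
Proof.
  destruct n as [|n].
  - exists (1 + Cmod z), 1. split; [lra|]. intros w Hw.
    assert (H := Cmod_triangle_rev w z). lra.
  - exists (fun _ => RtoC 1). split; [apply taylor_order_const|].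
    exists 1. split; [lra|]. intros; ring.
Qed.

Lemma taylor_order_plus (n : nat) (z : C) (f g : C -> C) :
  taylor_order n z f -> taylor_order n z g ->
  taylor_order n z (fun w => f w + g w)%C.
Proof.
  revert f g. induction n as [|n IH]; intros f g.
  - intros [B [d [Hd HB]]] [B' [e [He HB']]].
    exists (B + B'), (Rmin d e). split; [now apply Rmin_pos|]. intros w Hw.
    apply Rle_trans with (1 := Cmod_triangle _ _), Rplus_le_compat.
    + apply HB, Rlt_le_trans with (1 := Hw), Rmin_l.
    + apply HB', Rlt_le_trans with (1 := Hw), Rmin_r.
  - intros [k [Hk [d [Hd Hf]]]] [k' [Hk' [e [He Hg]]]].
    exists (fun w => k w + k' w)%C. split; [now apply IH|].
    exists (Rmin d e). split; [now apply Rmin_pos|]. intros w Hw.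
    rewrite (Hf w), (Hg w).
    + ring.
    + apply Rlt_le_trans with (1 := Hw), Rmin_r.
    + apply Rlt_le_trans with (1 := Hw), Rmin_l.
Qed.

Lemma taylor_order_mult (n : nat) (z : C) (f g : C -> C) :
  taylor_order n z f -> taylor_order n z g ->
  taylor_order n z (fun w => f w * g w)%C.
Proof.
  revert f g. induction n as [|n IH]; intros f g.
  - intros [B [d [Hd HB]]] [B' [e [He HB']]].
    exists (B * B'), (Rmin d e). split; [now apply Rmin_pos|]. intros w Hw.
    rewrite Cmod_mult. apply Rmult_le_compat; try apply Cmod_ge_0.
    + apply HB, Rlt_le_trans with (1 := Hw), Rmin_l.
    + apply HB', Rlt_le_trans with (1 := Hw), Rmin_r.
  - intros [k [Hk [d [Hd Hf]]]] Hg. generalize Hg.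
    intros [k' [Hk' [e [He Hg']]]].
    (* From f g - f(z) g(z) = (f - f(z)) g + f(z) (g - g(z)). *)
    exists (fun w => k w * g w + f z * k' w)%C. split.
    { apply taylor_order_plus; apply IH; auto using taylor_order_const.
      now apply taylor_order_S. }
    exists (Rmin d e). split; [now apply Rmin_pos|]. intros w Hw.
    rewrite (Hf w), (Hg' w).
    + ring.
    + apply Rlt_le_trans with (1 := Hw), Rmin_r.
    + apply Rlt_le_trans with (1 := Hw), Rmin_l.
Qed.

Lemma taylor_order_1_continuous (z : C) (f : C -> C) :
  taylor_order 1 z f -> forall eps, 0 < eps ->
  exists d, 0 < d /\ forall w, Cmod (w - z) < d -> Cmod (f w - f z) < eps.
Proof.
  intros [g [[B [e [He HB]]] [d [Hd Hf]]]] eps Heps.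
  assert (HB0 : 0 <= B).
  { apply Rle_trans with (1 := Cmod_ge_0 (g z)), HB.
    replace (z - z)%C with (RtoC 0) by ring. now rewrite Cmod_0. }
  assert (Hq : 0 < eps / (B + 1)) by (apply Rdiv_lt_0_compat; lra).
  exists (Rmin d (Rmin e (eps / (B + 1)))).
  split; [now repeat apply Rmin_pos|]. intros w Hw.
  assert (H0 := Rmin_l d (Rmin e (eps / (B + 1)))).
  assert (H1 := Rmin_r d (Rmin e (eps / (B + 1)))).
  assert (H2 := Rmin_l e (eps / (B + 1))).
  assert (H3 := Rmin_r e (eps / (B + 1))).
  rewrite (Hf w) by lra.
  replace (f z + (w - z) * g w - f z)%C with ((w - z) * g w)%C by ring.
  rewrite Cmod_mult.
  apply Rle_lt_trans with (Cmod (w - z) * (B + 1)).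
  - apply Rmult_le_compat_l; [apply Cmod_ge_0|].
    assert (Cmod (g w) <= B) by (apply HB; lra). lra.
  - replace eps with (eps / (B + 1) * (B + 1)) by (field; lra).
    apply Rmult_lt_compat_r; lra.
Qed.

Lemma taylor_order_nonzero_near (z : C) (f : C -> C) :
  taylor_order 1 z f -> f z <> RtoC 0 ->
  exists b d, 0 < b /\ 0 < d /\ forall w, Cmod (w - z) < d -> b <= Cmod (f w).
Proof.
  intros Hf Hz. apply Cmod_gt_0 in Hz.
  destruct (taylor_order_1_continuous z f Hf (Cmod (f z) / 2)) as [d [Hd H]]; [lra|].
  exists (Cmod (f z) / 2), d. repeat split; [lra|lra|]. intros w Hw.
  specialize (H w Hw). rewrite Cmod_sub_comm in H.
  assert (H1 := Cmod_triangle_rev (f z) (f w)). lra.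
Qed.

(** If g is the difference quotient of f, that of 1/f is -g / (f(z) f), whence the induction. Order
    1 is assumed apart from order [n] because order 0 is mere boundedness, while the base case needs
    f bounded away from 0. *)
Lemma taylor_order_inv (n : nat) (z : C) (f : C -> C) :
  taylor_order n z f -> taylor_order 1 z f -> f z <> RtoC 0 ->
  taylor_order n z (fun w => / f w)%C.
Proof.
  intros Hf H1 Hz.
  destruct (taylor_order_nonzero_near z f H1 Hz) as [b [d [Hb [Hd Hlow]]]].
  assert (Hnz : forall w, Cmod (w - z) < d -> f w <> RtoC 0).
  { intros w Hw. apply Cmod_gt_0. specialize (Hlow w Hw). lra. }
  induction n as [|n IH].
  - exists (/ b), d. split; [easy|]. intros w Hw.
    rewrite Cmod_inv by auto. apply Rinv_le_contravar; auto.
  - generalize Hf. intros [g [Hg [e [He Hf']]]].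
    exists (fun w => (- / f z) * (g w * / f w))%C. split.
    { apply taylor_order_mult; [apply taylor_order_const|].
      apply taylor_order_mult; [easy|]. now apply IH, taylor_order_S. }
    exists (Rmin d e). split; [now apply Rmin_pos|]. intros w Hw.
    assert (Hw0 : f w <> RtoC 0)
      by (apply Hnz, Rlt_le_trans with (1 := Hw), Rmin_l).
    transitivity (/ f z - (f w - f z) * (/ f z * / f w))%C.
    { field. now split. }
    rewrite (Hf' w) at 1 by (apply Rlt_le_trans with (1 := Hw), Rmin_r).
    ring.
Qed.

Lemma is_pseries_C_partial_sums (a : nat -> C) (x l : C) :
  @is_pseries C_AbsRing C_NormedModule a x l ->
  is_lim_seq
    (fun n => Cmod (@sum_n C_AbelianGroup (fun k => x ^ k * a k)%C n)) (Cmod l).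
Proof.
  intros H.
  assert (H1 := filterlim_comp _ _ _ _ _ _ _ _ H
    (@filterlim_norm C_AbsRing C_NormedModule l)).
  eapply filterlim_ext; [|exact H1].
  intros n. apply (f_equal Cmod).
  apply (@sum_n_ext C_AbelianGroup). intros k.
  change (pow_n x k * a k = x ^ k * a k)%C. reflexivity.
Qed.

(** Each term after the first is a difference of consecutive partial sums, and these are bounded. *)
Lemma pseries_C_terms_bounded (a : nat -> C) (x l : C) :
  @is_pseries C_AbsRing C_NormedModule a x l ->
  exists B, 0 <= B /\ forall k, Cmod (x ^ k * a k) <= B.
Proof.
  intros H. apply is_pseries_C_partial_sums in H.
  apply is_lim_seq_Reals in H.
  destruct (maj_by_pos _ (exist _ _ H)) as [B [HB Hsum]].
  assert (Hs : forall n,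
    Cmod (@sum_n C_AbelianGroup (fun k => x ^ k * a k)%C n) <= B).
  { intros n. specialize (Hsum n).
    now rewrite Rabs_pos_eq in Hsum by apply Cmod_ge_0. }
  exists (2 * B). split; [lra|]. intros [|k].
  - specialize (Hs O). rewrite sum_O in Hs. lra.
  - assert (H0 := Hs k). assert (H1 := Hs (S k)). rewrite sum_Sn in H1.
    change (Cmod (@sum_n C_AbelianGroup (fun k => x ^ k * a k)%C k
      + x ^ S k * a (S k)) <= B) in H1.
    assert (H2 := Cmod_triangle_rev (x ^ S k * a (S k))
      (- @sum_n C_AbelianGroup (fun k => x ^ k * a k)%C k)).
    rewrite Cmod_opp in H2.
    replace (x ^ S k * a (S k) - - @sum_n C_AbelianGroup (fun k => x ^ k * a k) k)%C
      with (@sum_n C_AbelianGroup (fun k => x ^ k * a k) k + x ^ S k * a (S k))%C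
      in H2 by ring.
    lra.
Qed.

(** Comparison with a geometric series: the terms at [z + d / 2] are bounded by some [B], so for |w
    - z| < d/4 the k-th term is at most B / 2^k. *)
Lemma pseries_C_locally_bounded (a : nat -> C) (z : C) (f : C -> C) (d : R) :
  0 < d ->
  (forall w, Cmod (w - z) < d ->
     @is_pseries C_AbsRing C_NormedModule a (w - z)%C (f w)) ->
  taylor_order 0 z f.
Proof.
  intros Hd Hf.
  destruct (pseries_C_terms_bounded a (RtoC (d / 2)) (f (z + RtoC (d / 2))%C))
    as [B [HB Hterm]].
  { replace (RtoC (d / 2)) with (z + RtoC (d / 2) - z)%C at 1 by ring.
    apply Hf. replace (z + RtoC (d / 2) - z)%C with (RtoC (d / 2)) by ring.
    rewrite Cmod_R, Rabs_pos_eq; lra. }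
  exists (2 * B), (d / 4). split; [lra|]. intros w Hw.
  assert (Hw' : Cmod (w - z) < d) by lra.
  assert (Hlim := is_pseries_C_partial_sums _ _ _ (Hf w Hw')).
  assert (Hk : forall k, Cmod ((w - z) ^ k * a k) <= B * (1 / 2) ^ k).
  { intros k. specialize (Hterm k).
    rewrite Cmod_mult, Cmod_pow in Hterm |- *.
    rewrite Cmod_R, Rabs_pos_eq in Hterm by lra.
    apply Rle_trans with ((d / 2 * (1 / 2)) ^ k * Cmod (a k)).
    - apply Rmult_le_compat_r; [apply Cmod_ge_0|].
      apply pow_incr. split; [apply Cmod_ge_0|lra].
    - rewrite Rpow_mult_distr.
      assert (0 <= (1 / 2) ^ k) by (apply pow_le; lra). nra. }
  assert (Hs : forall n,
    Cmod (@sum_n C_AbelianGroup (fun k => (w - z) ^ k * a k)%C n)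
      <= B * (2 - (1 / 2) ^ n)).
  { induction n as [|n IH].
    - rewrite sum_O. specialize (Hk O). simpl in Hk |- *. lra.
    - rewrite sum_Sn. eapply Rle_trans; [apply Cmod_triangle|].
      specialize (Hk (S n)). simpl in Hk |- *. lra. }
  apply (is_lim_seq_le _ _ _ (Finite (2 * B)) (fun n => Rle_trans _ _ (2 * B) (Hs n)
    ltac:(assert (0 < (1 / 2) ^ n) by (apply pow_lt; lra); nra)) Hlim).
  apply is_lim_seq_const.
Qed.

(** The difference quotient is the sum of the series with shifted coefficients, on the same disk, so
    induction on the order applies. Its value at [z] has to be [a 1]. *)
Lemma taylor_order_pseries (n : nat) (a : nat -> C) (z : C) (f : C -> C) (d : R) :
  0 < d ->
  (forall w, Cmod (w - z) < d ->
     @is_pseries C_AbsRing C_NormedModule a (w - z)%C (f w)) ->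
  taylor_order n z f.
Proof.
  intros Hd. revert a f. induction n as [|n IH]; intros a f Hf.
  { now apply pseries_C_locally_bounded with a d. }
  assert (Hz : Cmod (z - z) < d).
  { replace (z - z)%C with (RtoC 0) by ring. now rewrite Cmod_0. }
  assert (Hfz : f z = a O).
  { assert (H1 := Hf z Hz). assert (H2 := is_pseries_0 a).
    replace (z - z)%C with (RtoC 0) in H1 by ring.
    exact (filterlim_locally_unique _ _ _ H1 H2). }
  exists (fun w => if excluded_middle_informative (w = z) then a 1%nat
                   else ((f w - a O) * / (w - z))%C).
  split.
  - apply IH with (PS_decr_1 a). intros w Hw.
    destruct (excluded_middle_informative (w = z)) as [->|Hne].
    + replace (z - z)%C with (RtoC 0) by ring.
      apply (is_pseries_0 (PS_decr_1 a)).
    + assert (Hne' : (w - z)%C <> RtoC 0).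
      { intros H. apply Hne. replace w with (w - z + z)%C by ring.
        rewrite H. ring. }
      replace ((f w - a O) * / (w - z))%C with (/ (w - z) * (f w - a O))%C by ring.
      apply (is_pseries_decr_1 a (w - z)%C (/ (w - z))%C (f w)).
      * change (/ (w - z) * (w - z) = 1)%C. now field.
      * now apply Hf.
  - exists d. split; [easy|]. intros w Hw. rewrite Hfz.
    destruct (excluded_middle_informative (w = z)) as [->|Hne].
    + rewrite Hfz. ring.
    + field. intros H. apply Hne. replace w with (w - z + z)%C by ring.
      rewrite H. ring.
Qed.

Lemma analytic_taylor_order (n : nat) (A : C -> Prop) (f : C -> C) (z : C) :
  analytic_on A f -> A z -> taylor_order n z f.
Proof.
  intros Hf Hz. destruct (Hf z Hz) as [a [d Ha]].
  apply taylor_order_pseries with a d; [apply cond_pos|].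
  intros w Hw. apply Ha. now apply C_NormedModule_mixin_compat1.
Qed.

Lemma taylor_order_divide (n : nat) (z a : C) (f g : C -> C) :
  z <> a -> taylor_order n z f ->
  (forall w, w <> a -> g w = f w * / (w - a))%C ->
  taylor_order n z g.
Proof.
  intros Hne Hf Hg.
  assert (Hza : (z - a)%C <> RtoC 0).
  { intros H. apply Hne. replace z with (z - a + a)%C by ring. rewrite H. ring. }
  assert (Haff : forall m, taylor_order m z (fun w => w - a)%C).
  { intros m. apply taylor_order_plus; [apply taylor_order_id|].
    apply taylor_order_const. }
  apply taylor_order_ext with (fun w => f w * / (w - a))%C (Cmod (z - a)).
  - now apply Cmod_gt_0.
  - intros w Hw. symmetry. apply Hg. intros ->.
    rewrite Cmod_sub_comm in Hw. lra.
  - apply taylor_order_mult; [easy|]. now apply taylor_order_inv.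
Qed.

(** Division by [w - a] costs one order at the zero. Quantifying over [g] lets the caller use one
    globally defined quotient, completed by the value [c] at [a]. *)
Lemma taylor_order_divide_zero (n : nat) (a : C) (f : C -> C) :
  taylor_order (S n) a f -> f a = RtoC 0 ->
  exists c, forall g, g a = c ->
    (forall w, w <> a -> g w = f w * / (w - a))%C -> taylor_order n a g.
Proof.
  intros [k [Hk [d [Hd H]]]] Ha. exists (k a). intros g Hga Hg.
  apply taylor_order_ext with k d; [easy| |easy]. intros w Hw.
  destruct (excluded_middle_informative (w = a)) as [->|Hne]; [easy|].
  rewrite (Hg w Hne), (H w Hw), Ha. field.
  intros H0. apply Hne. replace w with (w - a + a)%C by ring. rewrite H0. ring.
Qed.

(** A discrete mean value property of quadratic polynomials: up to conjugation, the cross terms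
    carry the sums of i^j or i^(2j) over j = 0, ..., 3, which vanish. *)
Lemma four_point_mean (a b c : C) (r : R) :
  Cmod (a + RtoC r * b + (RtoC r * RtoC r) * c) ^ 2
  + Cmod (a + (Ci * RtoC r) * b + ((Ci * RtoC r) * (Ci * RtoC r)) * c) ^ 2
  + Cmod (a + (- RtoC r) * b + ((- RtoC r) * (- RtoC r)) * c) ^ 2
  + Cmod (a + (- (Ci * RtoC r)) * b
          + ((- (Ci * RtoC r)) * (- (Ci * RtoC r))) * c) ^ 2
  = 4 * (Cmod a ^ 2 + r ^ 2 * Cmod b ^ 2 + r ^ 4 * Cmod c ^ 2).
Proof.
  rewrite !Cmod2_alt. destruct a, b, c. unfold Re, Im. simpl. ring.
Qed.

Lemma Cmod2_usc (z : C) (f : C -> C) :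
  taylor_order 1 z f -> forall eps, 0 < eps ->
  exists d, 0 < d /\
    forall w, Cmod (w - z) < d -> Cmod (f w) ^ 2 < Cmod (f z) ^ 2 + eps.
Proof.
  intros Hf eps Heps.
  assert (H0 := Cmod_ge_0 (f z)).
  (* For eta <= 1, (|f z| + eta)^2 <= |f z|^2 + eta (2 |f z| + 1). *)
  set (eta := Rmin 1 (eps / (2 * Cmod (f z) + 1))).
  assert (Heta : 0 < eta)
    by (apply Rmin_pos; [lra|apply Rdiv_lt_0_compat; lra]).
  assert (Heta1 : eta <= 1) by apply Rmin_l.
  assert (Heta2 : eta * (2 * Cmod (f z) + 1) <= eps).
  { apply Rle_trans with (eps / (2 * Cmod (f z) + 1) * (2 * Cmod (f z) + 1)).
    - apply Rmult_le_compat_r; [lra|apply Rmin_r].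
    - right. field. lra. }
  destruct (taylor_order_1_continuous z f Hf eta Heta) as [d [Hd H]].
  exists d. split; [easy|]. intros w Hw. specialize (H w Hw).
  assert (H1 := Cmod_triangle_rev (f w) (f z)).
  assert (H2 := Cmod_ge_0 (f w)).
  nra.
Qed.

(* At an interior maximum the average over the four points [p + i^j r] exceeds the
   value at [p] by at least [eps r^2 - O(r^3)]. *)
Lemma maximum_principle_penalized (k eps : R) (g : C -> C) (z : C) :
  0 <= k -> 0 < eps ->
  (forall w, disk k w -> taylor_order 3 w g) -> disk k z ->
  exists w, Cmod w = k /\
    Cmod (g z) ^ 2 + eps * Cmod z ^ 2 <= Cmod (g w) ^ 2 + eps * Cmod w ^ 2.
Proof.
  intros Hk Heps Hg Hz.
  set (u := fun w => Cmod (g w) ^ 2 + eps * Cmod w ^ 2).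
  destruct (usc_attains_max_on_disk k u Hk) as [p [Hp Hmax]].
  { intros q Hq e He.
    destruct (Cmod2_usc q g) with (eps := e / 2) as [d [Hd H]]; [|lra|].
    { apply (taylor_order_le 1 3); [lia|auto]. }
    destruct (Cmod2_usc q (fun w => w)) with (eps := e / (2 * eps))
      as [d' [Hd' H']]; [apply taylor_order_id|apply Rdiv_lt_0_compat; lra|].
    exists (Rmin d d'). split; [now apply Rmin_pos|]. intros w Hw.
    assert (A1 := Rmin_l d d'). assert (A2 := Rmin_r d d').
    specialize (H w ltac:(lra)). specialize (H' w ltac:(lra)).
    apply (Rmult_lt_compat_l eps _ _ Heps) in H'.
    replace (eps * (Cmod q ^ 2 + e / (2 * eps)))
      with (eps * Cmod q ^ 2 + e / 2) in H' by (field; lra).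
    unfold u. lra. }
  exists p. split; [|now apply Hmax].
  destruct Hp as [Hp|Hp]; [exfalso|easy].
  assert (Hp' : disk k p) by (unfold disk; lra).
  destruct (Hg p Hp')
    as [g1 [[g2 [[g3 [[B [d3 [Hd3 HB]]] [d2 [Hd2 H2]]]] [d1 [Hd1 H1]]]] [d0 [Hd0 H0]]]].
  assert (HB0 : 0 <= B).
  { apply Rle_trans with (1 := Cmod_ge_0 (g3 p)), HB.
    replace (p - p)%C with (RtoC 0) by ring. now rewrite Cmod_0. }
  set (a := g p) in *. set (b := g1 p) in *. set (c := g2 p) in *.
  set (P := Cmod a + Cmod b + Cmod c).
  assert (HP : 0 <= P) by (unfold P; assert (A1 := Cmod_ge_0 a);
    assert (A2 := Cmod_ge_0 b); assert (A3 := Cmod_ge_0 c); lra).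
  (* The four points must lie in the disk and within reach of all the expansions; the last condition
     makes the cubic error smaller than the gain eps r^2. *)
  assert (exists r, 0 < r /\ r <= 1 /\ r < d0 /\ r < d1 /\ r < d2 /\ r < d3 /\
            r < k - Cmod p /\ 2 * P * B * r < eps) as [r Hr].
  { set (m := Rmin (Rmin (Rmin d0 d1) (Rmin d2 d3))
       (Rmin (Rmin 1 (k - Cmod p)) (eps / (2 * P * B + 1)))).
    assert (HPB : 0 <= P * B) by now apply Rmult_le_pos.
    assert (He : 0 < eps / (2 * P * B + 1)) by (apply Rdiv_lt_0_compat; lra).
    assert (Hm : 0 < m) by (unfold m; repeat apply Rmin_pos; lra).
    assert (m <= d0 /\ m <= d1 /\ m <= d2 /\ m <= d3 /\ m <= 1 /\ m <= k - Cmod p /\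
            m <= eps / (2 * P * B + 1)) as Hmm.
    { unfold m, Rmin. repeat destruct Rle_dec; repeat split; lra. }
    exists (m / 2). repeat split; try lra.
    apply Rlt_le_trans with ((2 * P * B + 1) * (eps / (2 * P * B + 1))); [nra|].
    right. field. lra. }
  (* [P] bounds the quadratic part q and [B * r ^ 3] the remainder e, so |q|^2 - |q + e|^2 <= 2 P B
     r^3. *)
  assert (Hpt : forall x, Cmod x = r ->
    Cmod (a + x * b + (x * x) * c) ^ 2 - 2 * P * B * r ^ 3
      + eps * Cmod (p + x) ^ 2 <= u p).
  { intros x Hx.
    assert (Hd : Cmod (p + x) <= k).
    { apply Rle_trans with (1 := Cmod_triangle _ _). lra. }
    specialize (Hmax (p + x)%C Hd).
    apply Rle_trans with (2 := Hmax). unfold u.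
    apply Rplus_le_compat_r.
    assert (Hxx : (p + x - p = x)%C) by ring.
    assert (Hgx : g (p + x)%C
      = (a + x * b + (x * x) * c + (x * (x * x)) * g3 (p + x))%C).
    { rewrite H0, H1, H2 by (rewrite Hxx; lra). rewrite !Hxx. fold a b c. ring. }
    rewrite Hgx.
    set (q := (a + x * b + (x * x) * c)%C).
    assert (He : Cmod ((x * (x * x)) * g3 (p + x)%C) <= B * r ^ 3).
    { rewrite !Cmod_mult, Hx.
      assert (Cmod (g3 (p + x)%C) <= B) by (apply HB; rewrite Hxx; lra).
      assert (0 <= r * (r * r)) by (repeat apply Rmult_le_pos; lra). nra. }
    set (e := ((x * (x * x)) * g3 (p + x))%C) in *.
    assert (Hq : Cmod q <= P).
    { unfold q, P. apply Rle_trans with (1 := Cmod_triangle _ _).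
      assert (T := Cmod_triangle a (x * b)).
      assert (T' : Cmod ((x * x) * c) = r * r * Cmod c)
        by now rewrite !Cmod_mult, Hx.
      rewrite Cmod_mult, Hx in T.
      assert (A1 := Cmod_ge_0 a); assert (A2 := Cmod_ge_0 b);
      assert (A3 := Cmod_ge_0 c). 
      destruct Hr as (Hr1 & Hr2 & _).
      assert (r * Cmod b <= 1 * Cmod b) by (apply Rmult_le_compat_r; lra).
      assert (r * r * Cmod c <= 1 * Cmod c) by (apply Rmult_le_compat_r; nra).
      lra. }
    assert (Hqe := Cmod_triangle_rev q (- e)).
    replace (q - - e)%C with (q + e)%C in Hqe by ring.
    rewrite Cmod_opp in Hqe.
    assert (A1 := Cmod_ge_0 q). assert (A2 := Cmod_ge_0 (q + e)).
    assert (A3 := Cmod_ge_0 e).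
    assert (Cmod q * Cmod e <= P * (B * r ^ 3)) by now apply Rmult_le_compat.
    assert (Cmod q ^ 2 - Cmod (q + e) ^ 2 <= 2 * (Cmod q * Cmod e)).
    { destruct (Rle_dec (Cmod q) (Cmod (q + e))); nra. }
    nra. }
  assert (Hr0 : Cmod (RtoC r) = r) by (rewrite Cmod_R, Rabs_pos_eq; lra).
  assert (Hir : Cmod (Ci * RtoC r) = r) by (rewrite Cmod_mult, Cmod_Ci, Hr0; ring).
  assert (Q1 := Hpt _ Hr0). assert (Q2 := Hpt _ Hir).
  assert (Q3 := Hpt (- RtoC r)%C (eq_trans (Cmod_opp _) Hr0)).
  assert (Q4 := Hpt (- (Ci * RtoC r))%C (eq_trans (Cmod_opp _) Hir)).
  assert (M1 := four_point_mean a b c r).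
  assert (M2 : Cmod (p + RtoC r) ^ 2 + Cmod (p + Ci * RtoC r) ^ 2
    + Cmod (p + - RtoC r) ^ 2 + Cmod (p + - (Ci * RtoC r)) ^ 2
    = 4 * (Cmod p ^ 2 + r ^ 2)).
  { rewrite !Cmod2_alt. destruct p. unfold Re, Im. simpl. ring. }
  unfold u in Q1, Q2, Q3, Q4. fold a in Q1, Q2, Q3, Q4.
  assert (0 <= r ^ 2 * Cmod b ^ 2) by (apply Rmult_le_pos; apply pow2_ge_0).
  assert (0 <= r ^ 4 * Cmod c ^ 2)
    by (apply Rmult_le_pos; [apply pow_le; lra|apply pow2_ge_0]).
  (* The average of the four inequalities; it contradicts the choice of [r]. *)
  assert (Hfin : eps * r ^ 2 <= 2 * P * B * r ^ 3) by nra.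
  assert (Hr2 : 0 < r ^ 2) by (apply pow_lt; lra).
  assert (2 * P * B * r * r ^ 2 < eps * r ^ 2) by (apply Rmult_lt_compat_r; lra).
  nra.
Qed.

Lemma maximum_principle (k B : R) (g : C -> C) (z : C) :
  0 <= k -> 0 <= B -> (forall w, disk k w -> taylor_order 3 w g) ->
  (forall w, Cmod w = k -> Cmod (g w) <= B) ->
  disk k z -> Cmod (g z) <= B.
Proof.
  intros Hk HB Hg Hbd Hz. apply Rnot_lt_le. intros Hlt.
  (* The penalty eps k^2 stays below half of the gap |g z|^2 - B^2; the added 1 covers k = 0. *)
  set (eps := (Cmod (g z) ^ 2 - B ^ 2) / (2 * (k ^ 2 + 1))).
  assert (Hsq : 0 < Cmod (g z) ^ 2 - B ^ 2) by nra.
  assert (Hk2 : 0 <= k ^ 2) by apply pow2_ge_0.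
  assert (Heps : 0 < eps) by (apply Rdiv_lt_0_compat; lra).
  destruct (maximum_principle_penalized k eps g z Hk Heps Hg Hz) as [w [Hw H]].
  specialize (Hbd w Hw). rewrite Hw in H.
  assert (A := Cmod_ge_0 (g w)).
  assert (Cmod (g w) ^ 2 <= B ^ 2) by (apply pow_incr; lra).
  assert (0 <= eps * Cmod z ^ 2) by (apply Rmult_le_pos; [lra|apply pow2_ge_0]).
  assert (eps * (2 * (k ^ 2 + 1)) = Cmod (g z) ^ 2 - B ^ 2)
    by (unfold eps; field; lra).
  nra.
Qed.

(** * Schwarz-Pick and Lagrange interpolation *)

Lemma Csub_neq_0 (z w : C) : z <> w -> (z - w)%C <> RtoC 0.
Proof.
  intros Hne H. apply Hne. replace z with (z - w + w)%C by ring. rewrite H. ring.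
Qed.

(** Division costs an order only at [a]. Elsewhere order 4 survives, so [divide_out_zeros] can go on
    to the next zero. *)
Lemma divide_out_zero (k : R) (a : C) (f : C -> C) :
  (forall w, disk k w -> taylor_order 3 w f) ->
  taylor_order 4 a f -> f a = RtoC 0 ->
  exists g, (forall w, disk k w -> taylor_order 3 w g) /\
    (forall w, w <> a -> taylor_order 4 w f -> taylor_order 4 w g) /\
    forall w, f w = ((w - a) * g w)%C.
Proof.
  intros Hf Hfa Ha.
  destruct (taylor_order_divide_zero 3 a f Hfa Ha) as [c Hc].
  set (g := fun w => if excluded_middle_informative (w = a) then c
                     else (f w * / (w - a))%C).
  assert (Hga : g a = c) by (unfold g; now destruct excluded_middle_informative).
  assert (Hg : forall w, w <> a -> g w = (f w * / (w - a))%C)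
    by (intros w Hw; unfold g; now destruct excluded_middle_informative).
  exists g. repeat split.
  - intros w Hw. destruct (classic (w = a)) as [->|Hne].
    + now apply Hc.
    + apply taylor_order_divide with a f; auto.
  - intros w Hw Hfw. now apply taylor_order_divide with a f.
  - intros w. destruct (classic (w = a)) as [->|Hne].
    + rewrite Ha. ring.
    + rewrite (Hg w Hne). field. now apply Csub_neq_0.
Qed.

(* Schwarz-Pick for the disk of radius 4, with the constant [m > M] in place of
   [M] to keep the denominator away from 0. *)
Lemma schwarz_pick_disk4 (f : C -> C) (M m : R) (z : C) :
  (forall n w, disk 4 w -> taylor_order n w f) ->
  (forall w, disk 4 w -> Cmod (f w) <= M) -> M < m -> disk 1 z ->
  4 * m * Cmod (f z - f (RtoC 0)) <= Cmod (RtoC (m ^ 2) - Cconj (f (RtoC 0)) * f z).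
Proof.
  intros Hf HM Hm Hz.
  assert (D0 : disk 4 (RtoC 0)) by (unfold disk; rewrite Cmod_0; lra).
  assert (Dz : disk 4 z) by (unfold disk in *; lra).
  set (c := f (RtoC 0)).
  assert (Hc : Cmod c <= M) by now apply HM.
  assert (Hc0 := Cmod_ge_0 c).
  destruct (divide_out_zero 4 (RtoC 0) (fun w => f w + - c)%C) as [g [Hg [_ Hfg]]].
  { intros w Hw. apply taylor_order_plus; [auto|apply taylor_order_const]. }
  { apply taylor_order_plus; [auto|apply taylor_order_const]. }
  { fold c. ring. }
  set (h := fun w => (RtoC (m ^ 2) + - Cconj c * f w)%C).
  assert (Hh0 : forall w, disk 4 w -> h w <> RtoC 0).
  { intros w Hw H. specialize (HM w Hw).
    assert (H1 := Cmod_triangle_rev (RtoC (m ^ 2)) (Cconj c * f w)).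
    replace (RtoC (m ^ 2) - Cconj c * f w)%C with (h w) in H1 by (unfold h; ring).
    rewrite H, Cmod_0, Cmod_mult, Cmod_conj, Cmod_R, Rabs_pos_eq in H1
      by apply pow2_ge_0.
    assert (Cmod c * Cmod (f w) <= M * M)
      by (apply Rmult_le_compat; auto using Cmod_ge_0).
    nra. }
  assert (Hh : forall n w, disk 4 w -> taylor_order n w h).
  { intros n w Hw. apply taylor_order_plus; [apply taylor_order_const|].
    apply taylor_order_mult; [apply taylor_order_const|auto]. }
  (* On the circle |w| = 4 one has |f - c| = 4 |g|, so the bound there amounts to m |f - c| <=
     |h|. *)
  assert (Hmax : Cmod (g z * / h z) <= / (4 * m)).
  { apply (maximum_principle 4 _ (fun w => g w * / h w)%C); [lra| | | |easy].
    - left. apply Rinv_0_lt_compat. lra.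
    - intros w Hw. apply taylor_order_mult; [auto|].
      apply taylor_order_inv; auto.
    - intros w Hw.
      assert (Dw : disk 4 w) by (unfold disk; lra).
      assert (Hhw : 0 < Cmod (h w)) by now apply Cmod_gt_0, Hh0.
      rewrite Cmod_mult, Cmod_inv by auto.
      assert (E : Cmod (f w - c) = 4 * Cmod (g w)).
      { specialize (Hfg w). simpl in Hfg.
        replace (f w - c)%C with (f w + - c)%C by ring.
        rewrite Hfg, Cmod_mult.
        replace (w - 0)%C with w by ring. now rewrite Hw. }
      (* |h|^2 - m^2 |f - c|^2 = (m^2 - |f|^2) (m^2 - |c|^2) >= 0. *)
      assert (E2 : m * Cmod (f w - c) <= Cmod (h w)).
      { specialize (HM w Dw). assert (F0 := Cmod_ge_0 (f w)).
        assert (F1 := Cmod_ge_0 (f w - c)).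
        apply Rsqr_incr_0; [|nra|lra]. unfold Rsqr.
        assert (K1 := Cmod2_alt (f w)). assert (K2 := Cmod2_alt c).
        assert (K3 := Cmod2_alt (f w - c)). assert (K4 := Cmod2_alt (h w)).
        unfold h in K4 at 2 3.
        assert (P : 0 <= (m ^ 2 - Cmod (f w) ^ 2) * (m ^ 2 - Cmod c ^ 2))
          by (apply Rmult_le_pos; nra).
        rewrite K1, K2 in P.
        replace (m * Cmod (f w - c) * (m * Cmod (f w - c)))
          with (m ^ 2 * Cmod (f w - c) ^ 2) by ring.
        replace (Cmod (h w) * Cmod (h w)) with (Cmod (h w) ^ 2) by ring.
        rewrite K3, K4. clear - P. destruct (f w) as [x y], c as [u v].
        unfold Re, Im in *. simpl in *. nra. }
      apply Rmult_le_reg_r with (Cmod (h w) * (4 * m)); [nra|].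
      replace (Cmod (g w) * / Cmod (h w) * (Cmod (h w) * (4 * m)))
        with (m * (4 * Cmod (g w))) by (field; lra).
      replace (/ (4 * m) * (Cmod (h w) * (4 * m))) with (Cmod (h w)) by (field; lra).
      now rewrite <- E. }
  assert (Hhz : 0 < Cmod (h z)) by now apply Cmod_gt_0, Hh0.
  replace (RtoC (m ^ 2) - Cconj c * f z)%C with (h z) by (unfold h; ring).
  rewrite Cmod_mult, Cmod_inv in Hmax by auto.
  replace (f z - c)%C with (f z + - c)%C by ring.
  rewrite (Hfg z), Cmod_mult. replace (z - 0)%C with z by ring.
  apply (Rmult_le_compat_r (Cmod (h z) * (4 * m))) in Hmax; [|nra].
  replace (Cmod (g z) * / Cmod (h z) * (Cmod (h z) * (4 * m)))
    with (4 * m * Cmod (g z)) in Hmax by (field; lra).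
  replace (/ (4 * m) * (Cmod (h z) * (4 * m))) with (Cmod (h z)) in Hmax
    by (field; lra).
  apply Rle_trans with (2 := Hmax).
  unfold disk in Hz. assert (A := Cmod_ge_0 (g z)).
  assert (Cmod z * Cmod (g z) <= 1 * Cmod (g z)) by (apply Rmult_le_compat_r; lra).
  nra.
Qed.

(** With a = |f 0| and F = |f z|, Schwarz-Pick and the limit m -> M give F >= M (4 a - M) / (4 M -
    a). For a >= 1 and M <= 2 the right side is at least M^(-2). *)
Lemma lower_bound_small_max (f : C -> C) (M : R) (z : C) :
  (forall n w, disk 4 w -> taylor_order n w f) ->
  (forall w, disk 4 w -> Cmod (f w) <= M) ->
  1 <= Cmod (f (RtoC 0)) -> M <= 2 -> disk 1 z -> M <= M ^ 9 * Cmod (f z).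
Proof.
  intros Hf HM H1 H2 Hz.
  assert (D0 : disk 4 (RtoC 0)) by (unfold disk; rewrite Cmod_0; lra).
  set (a := Cmod (f (RtoC 0))) in *. set (F := Cmod (f z)) in *.
  assert (Ha : a <= M) by now apply HM.
  assert (HF0 : 0 <= F) by apply Cmod_ge_0.
  assert (HFM : F <= M) by (apply HM; unfold disk in *; lra).
  assert (Hall : forall m, M < m -> m * (4 * a - m) <= F * (4 * m - a)).
  { intros m Hm. assert (S := schwarz_pick_disk4 f M m z Hf HM Hm Hz).
    assert (haF : a * F < m * m) by nra.
    assert (Hsq : (4 * m * (a - F)) ^ 2 <= (m ^ 2 - a * F) ^ 2).
    { assert (K1 := Cmod2_alt (f z)). assert (K2 := Cmod2_alt (f (RtoC 0))).
      fold F in K1. fold a in K2.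
      assert (K3 := Cmod2_alt (f z - f (RtoC 0))).
      assert (K4 := Cmod2_alt (RtoC (m ^ 2) - Cconj (f (RtoC 0)) * f z)).
      assert (Ssq : (4 * m) ^ 2 * Cmod (f z - f (RtoC 0)) ^ 2
        <= Cmod (RtoC (m ^ 2) - Cconj (f (RtoC 0)) * f z) ^ 2).
      { rewrite <- Rpow_mult_distr. apply pow_incr. split; [|easy].
        apply Rmult_le_pos; [lra|apply Cmod_ge_0]. }
      (* The squared Schwarz-Pick inequality is linear in this inner product, and the sign of its
         coefficient allows replacing it by the Cauchy-Schwarz bound a F. *)
      assert (HRe : Re (f z) * Re (f (RtoC 0)) + Im (f z) * Im (f (RtoC 0))
                    <= a * F).
      { apply Rsqr_incr_0_var; [unfold Rsqr|apply Rmult_le_pos; lra].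
        replace (a * F * (a * F)) with (a ^ 2 * F ^ 2) by ring.
        rewrite K1, K2.
        assert (0 <= (Re (f z) * Im (f (RtoC 0)) - Im (f z) * Re (f (RtoC 0))) ^ 2)
          by apply pow2_ge_0. nra. }
      rewrite K3, K4 in Ssq. clear - K1 K2 Ssq HRe Hm H1 Ha.
      destruct (f z) as [x y], (f (RtoC 0)) as [u v].
      unfold Re, Im in *. simpl in *.
      set (R := x * u + y * v) in *.
      assert (0 <= 30 * m ^ 2 * (a * F - R)) by (apply Rmult_le_pos; nra).
      assert (Q : 16 * m ^ 2 * (F ^ 2 + a ^ 2 - 2 * R)
                  <= m ^ 4 - 2 * m ^ 2 * R + a ^ 2 * F ^ 2).
      { replace (F ^ 2) with (x * x + y * y) by (simpl in *; lra).
        replace (a ^ 2) with (u * u + v * v) by (simpl in *; lra).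
        unfold R. nra. }
      nra. }
    assert (4 * m * (a - F) <= m ^ 2 - a * F)
      by (apply Rsqr_incr_0_var; [unfold Rsqr; nra|nra]).
    nra. }
  assert (Hlim : M * (4 * a - M) <= F * (4 * M - a)).
  { apply Rnot_lt_le. intros Hgap.
    (* Passing from M to M + e lowers the gap by less than e (4 F + 2 M + 2), hence leaves it
       positive. *)
    set (e := Rmin 1 ((M * (4 * a - M) - F * (4 * M - a)) / (4 * F + 2 * M + 2))).
    assert (He : 0 < e) by (apply Rmin_pos; [lra|apply Rdiv_lt_0_compat; lra]).
    assert (He1 : e <= 1) by apply Rmin_l.
    assert (He2 : e * (4 * F + 2 * M + 2) <= M * (4 * a - M) - F * (4 * M - a)).
    { apply Rle_trans with
        ((M * (4 * a - M) - F * (4 * M - a)) / (4 * F + 2 * M + 2)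
         * (4 * F + 2 * M + 2)).
      - apply Rmult_le_compat_r; [lra|apply Rmin_r].
      - right. field. lra. }
    specialize (Hall (M + e) ltac:(lra)). nra. }
  assert (H3 : M * (4 - M) <= F * (4 * M - 1)) by nra.
  assert (H4 : 4 * M - 1 <= M ^ 3 * (4 - M)).
  { set (t := M - 1). replace M with (1 + t) by (unfold t; ring).
    assert (0 <= t <= 1) by (unfold t; lra).
    assert (0 <= t * (1 - t)) by nra.
    replace ((1 + t) ^ 3 * (4 - (1 + t)))
      with (3 + 8 * t + 6 * t ^ 2 - t ^ 2 * t ^ 2) by ring.
    nra. }
  assert (H5 : M <= M ^ 3 * F).
  { apply Rmult_le_reg_r with (4 * M - 1); [lra|].
    apply Rle_trans with (M * (M ^ 3 * (4 - M))).
    - apply Rmult_le_compat_l; lra.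
    - replace (M * (M ^ 3 * (4 - M))) with (M ^ 3 * (M * (4 - M))) by ring.
      rewrite Rmult_assoc. apply Rmult_le_compat_l; [apply pow_le; lra|lra]. }
  apply Rle_trans with (1 := H5). apply Rmult_le_compat_r; [lra|].
  apply Rle_pow; [lra|lia].
Qed.

Definition cprod (l : list R) (w : C) : C :=
  fold_right (fun b p => (w - RtoC b) * p)%C (RtoC 1) l.

Definition rprod (l : list R) (x : R) : R :=
  fold_right (fun b p => Rabs (x - b) * p) 1 l.

Lemma Cmod_cprod_R (l : list R) (x : R) : Cmod (cprod l (RtoC x)) = rprod l x.
Proof.
  induction l as [|b l IH]; simpl; [apply Cmod_1|].
  rewrite Cmod_mult, IH. f_equal. now rewrite <- RtoC_minus, Cmod_R.
Qed.

Lemma cprod_bounds (l : list R) (w : C) (A B : R) :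
  0 <= A -> (forall b, In b l -> A <= Cmod (w - RtoC b) <= B) ->
  A ^ length l <= Cmod (cprod l w) <= B ^ length l.
Proof.
  intros HA. induction l as [|b l IH]; simpl; intros H.
  - rewrite Cmod_1. lra.
  - rewrite Cmod_mult.
    destruct (H b) as [H1 H2]; [now left|].
    destruct IH as [H3 H4]; [auto|].
    assert (0 <= A ^ length l) by now apply pow_le.
    split; apply Rmult_le_compat; auto using Cmod_ge_0.
Qed.

Lemma cprod_zero (l : list R) (b : R) : In b l -> cprod l (RtoC b) = RtoC 0.
Proof.
  induction l as [|x l IH]; simpl; [easy|]. intros [->|H].
  - ring.
  - rewrite IH by easy. ring.
Qed.

Lemma taylor_order_cprod (n : nat) (z : C) (l : list R) :
  taylor_order n z (cprod l).
Proof.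
  induction l as [|b l IH]; [exact (taylor_order_const n z 1)|].
  apply (taylor_order_mult n z (fun w => w - RtoC b)%C (cprod l)); [|easy].
  apply taylor_order_plus; [apply taylor_order_id|apply taylor_order_const].
Qed.

Lemma divide_out_zeros (k : R) (l : list R) (f : C -> C) :
  NoDup l -> (forall w, disk k w -> taylor_order 3 w f) ->
  (forall b, In b l -> taylor_order 4 (RtoC b) f /\ f (RtoC b) = RtoC 0) ->
  exists g, (forall w, disk k w -> taylor_order 3 w g) /\
    forall w, f w = (cprod l w * g w)%C.
Proof.
  revert f. induction l as [|b l IH]; intros f Hl Hf Hz.
  - exists f. split; [easy|]. intros w. simpl. ring.
  - inversion Hl as [|? ? Hb Hl']; subst.
    destruct (Hz b) as [Hb4 Hb0]; [now left|].
    destruct (divide_out_zero k (RtoC b) f Hf Hb4 Hb0) as [h [Hh [Hh4 Hfh]]].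
    destruct (IH h Hl' Hh) as [g [Hg Hhg]].
    + intros x Hx.
      assert (Hne : RtoC x <> RtoC b).
      { intros E. apply RtoC_inj in E. now subst. }
      destruct (Hz x) as [Hx4 Hx0]; [now right|]. split; [auto|].
      rewrite Hfh in Hx0. apply Cmod_eq_0.
      assert (E : Cmod ((RtoC x - RtoC b) * h (RtoC x)) = 0)
        by (rewrite Hx0; apply Cmod_0).
      rewrite Cmod_mult in E. apply Rmult_integral in E. destruct E as [E|E]; [|easy].
      apply Cmod_eq_0 in E. now apply Csub_neq_0 in E.
    + exists g. split; [easy|]. intros w. simpl. rewrite Hfh, Hhg. ring.
Qed.

Definition lagrange_basis (l : list R) (b : R) (w : C) : C :=
  (/ cprod (remove Req_dec_T b l) (RtoC b) * cprod (remove Req_dec_T b l) w)%C.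

(** The summation list [m] is separate from the nodes [l]: inductions shorten [m] while the basis
    polynomials stay those of [l]. *)
Definition lagrange_sum (f : C -> C) (l m : list R) (w : C) : C :=
  fold_right (fun b p => f (RtoC b) * lagrange_basis l b w + p)%C (RtoC 0) m.

Lemma taylor_order_lagrange_sum (n : nat) (z : C) (f : C -> C) (l m : list R) :
  taylor_order n z (lagrange_sum f l m).
Proof.
  induction m as [|b m IH]; [exact (taylor_order_const n z 0)|].
  apply (taylor_order_plus n z (fun w => f (RtoC b) * lagrange_basis l b w)%C
    (lagrange_sum f l m)); [|easy].
  apply taylor_order_mult; [apply taylor_order_const|].
  apply taylor_order_mult; [apply taylor_order_const|apply taylor_order_cprod].
Qed.

(** The second half serves the induction: once the summand of [x] is split off, the others
    contribute 0 at [x]. *)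
Lemma lagrange_sum_node (f : C -> C) (l m : list R) (x : R) :
  NoDup m -> In x l -> cprod (remove Req_dec_T x l) (RtoC x) <> RtoC 0 ->
  (In x m -> lagrange_sum f l m (RtoC x) = f (RtoC x)) /\
  (~ In x m -> lagrange_sum f l m (RtoC x) = RtoC 0).
Proof.
  intros Hm Hx Hnz. induction Hm as [|b m Hb Hm [IH1 IH2]]; simpl.
  - split; [easy|now intros _].
  - destruct (Req_dec_T x b) as [<-|Hne].
    + split; [|tauto]. intros _. rewrite IH2 by easy. unfold lagrange_basis.
      rewrite Cinv_l by easy. ring.
    + assert (E : lagrange_basis l b (RtoC x) = RtoC 0).
      { unfold lagrange_basis. rewrite (cprod_zero _ x); [ring|].
        now apply in_in_remove. }
      rewrite E. split.
      * intros [H|H]; [congruence|]. rewrite IH1 by easy. ring.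
      * intros H. rewrite IH2 by tauto. ring.
Qed.

Lemma lagrange_sum_bound (f : C -> C) (l m : list R) (w : C) (s d : R) :
  0 < d -> 0 <= s ->
  (forall b, In b l -> Rabs b <= 1) -> disk 4 w ->
  (forall b, In b m -> Cmod (f (RtoC b)) <= s /\ d <= rprod (remove Req_dec_T b l) b) ->
  Cmod (lagrange_sum f l m w) <= INR (length m) * (s * (5 ^ length l / d)).
Proof.
  intros Hd Hs Hl Hw. induction m as [|b m IH]; intros Hm.
  - simpl. rewrite Cmod_0. lra.
  - cbn [lagrange_sum fold_right length]. fold (lagrange_sum f l m w).
    apply Rle_trans with (1 := Cmod_triangle _ _).
    rewrite S_INR, Rmult_plus_distr_r, Rplus_comm, Rmult_1_l.
    apply Rplus_le_compat.
    { apply IH. intros x Hx. apply Hm. now right. }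
    destruct (Hm b) as [H1 H2]; [now left|].
    rewrite <- Cmod_cprod_R in H2.
    unfold lagrange_basis. rewrite !Cmod_mult, Cmod_inv
      by (apply Cmod_gt_0; lra).
    apply Rmult_le_compat; [apply Cmod_ge_0| |easy|].
    { apply Rmult_le_pos; [|apply Cmod_ge_0].
      left. apply Rinv_0_lt_compat. lra. }
    rewrite Rmult_comm. apply Rmult_le_compat.
    + apply Cmod_ge_0.
    + left. apply Rinv_0_lt_compat. lra.
    + apply Rle_trans with (5 ^ length (remove Req_dec_T b l)).
      * apply (cprod_bounds _ w 0 5); [lra|]. intros x Hx.
        split; [apply Cmod_ge_0|].
        apply in_remove in Hx. specialize (Hl x (proj1 Hx)).
        apply Rle_trans with (1 := Cmod_triangle _ _).
        rewrite Cmod_opp, Cmod_R. unfold disk in Hw. lra.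
      * apply Rle_pow; [lra|]. apply remove_length_le.
    + now apply Rinv_le_contravar.
Qed.

(** The interpolant, bounded by [B] on the disk, enters twice: by its value at 0, and through (M +
    B) / 3^N, the bound for the quotient by the node polynomial. Hence the factor 2. *)
Lemma interpolation_bound (f : C -> C) (l : list R) (M s d : R) :
  (forall n w, disk 4 w -> taylor_order n w f) ->
  (forall w, disk 4 w -> Cmod (f w) <= M) ->
  NoDup l -> (forall b, In b l -> Rabs b <= 1) -> 0 < d -> 0 <= s ->
  (forall b, In b l -> Cmod (f (RtoC b)) <= s /\ d <= rprod (remove Req_dec_T b l) b) ->
  Cmod (f (RtoC 0))
    <= M / 3 ^ length l + 2 * (INR (length l) * (s * (5 ^ length l / d))).
Proof.
  intros Hf HM Hl Hl1 Hd Hs Hb.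
  assert (D0 : disk 4 (RtoC 0)) by (unfold disk; rewrite Cmod_0; lra).
  assert (HM0 : 0 <= M) by (apply Rle_trans with (2 := HM _ D0), Cmod_ge_0).
  set (B := INR (length l) * (s * (5 ^ length l / d))).
  assert (HL : forall w, disk 4 w -> Cmod (lagrange_sum f l l w) <= B)
    by (intros w Hw; now apply lagrange_sum_bound).
  assert (HB : 0 <= B) by (apply Rle_trans with (2 := HL _ D0), Cmod_ge_0).
  assert (HF : forall n w, disk 4 w ->
    taylor_order n w (fun w => f w + - RtoC 1 * lagrange_sum f l l w)%C).
  { intros n w Hw. apply taylor_order_plus; [auto|].
    apply taylor_order_mult; [apply taylor_order_const|].
    apply taylor_order_lagrange_sum. }
  destruct (divide_out_zeros 4 l
    (fun w => f w + - RtoC 1 * lagrange_sum f l l w)%C Hl) as [g [Hg Hfg]].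
  { intros w Hw. now apply HF. }
  { intros b Hbl. split.
    - apply HF. unfold disk. rewrite Cmod_R. specialize (Hl1 b Hbl). lra.
    - rewrite (proj1 (lagrange_sum_node f l l b Hl Hbl
        ltac:(apply Cmod_gt_0; rewrite Cmod_cprod_R; destruct (Hb b Hbl); lra)) Hbl).
      ring. }
  assert (Hg0 : Cmod (g (RtoC 0)) <= (M + B) / 3 ^ length l).
  { assert (H3 : 0 < 3 ^ length l) by (apply pow_lt; lra).
    apply (maximum_principle 4); [lra| |easy| |easy].
    - apply Rdiv_le_0_compat; lra.
    - intros w Hw.
      assert (Dw : disk 4 w) by (unfold disk; lra).
      assert (Hc : 3 ^ length l <= Cmod (cprod l w)).
      { apply (cprod_bounds l w 3 5); [lra|]. intros b Hbl.
        specialize (Hl1 b Hbl).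
        assert (T1 := Cmod_triangle_rev w (RtoC b)).
        assert (T2 := Cmod_triangle w (- RtoC b)).
        rewrite Cmod_opp in T2. rewrite Cmod_R in T1, T2.
        change (w + - RtoC b)%C with (w - RtoC b)%C in T2. lra. }
      apply Rmult_le_reg_r with (3 ^ length l); [easy|].
      replace ((M + B) / 3 ^ length l * 3 ^ length l) with (M + B) by (field; lra).
      apply Rle_trans with (Cmod (cprod l w * g w)).
      + rewrite Cmod_mult, Rmult_comm.
        apply Rmult_le_compat_r; [apply Cmod_ge_0|easy].
      + rewrite <- Hfg. apply Rle_trans with (1 := Cmod_triangle _ _).
        rewrite Cmod_mult, Cmod_opp, Cmod_1, Rmult_1_l.
        apply Rplus_le_compat; auto. }
  assert (Hp0 : Cmod (cprod l (RtoC 0)) <= 1).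
  { replace 1 with (1 ^ length l) by apply pow1.
    apply (cprod_bounds l _ 0 1); [lra|]. intros b Hbl.
    split; [apply Cmod_ge_0|].
    replace (RtoC 0 - RtoC b)%C with (- RtoC b)%C by ring.
    rewrite Cmod_opp, Cmod_R. auto. }
  assert (E : f (RtoC 0) = (lagrange_sum f l l (RtoC 0) + cprod l (RtoC 0) * g (RtoC 0))%C).
  { rewrite <- Hfg. ring. }
  rewrite E. apply Rle_trans with (1 := Cmod_triangle _ _).
  rewrite Cmod_mult.
  assert (H1 := HL _ D0).
  assert (H2 : Cmod (cprod l (RtoC 0)) * Cmod (g (RtoC 0)) <= 1 * ((M + B) / 3 ^ length l))
    by (apply Rmult_le_compat; auto using Cmod_ge_0).
  assert (H3 : 1 <= 3 ^ length l) by (apply pow_R1_Rle; lra).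
  assert (H4 : B / 3 ^ length l <= B).
  { apply Rmult_le_reg_r with (3 ^ length l); [lra|].
    replace (B / 3 ^ length l * 3 ^ length l) with B by (field; lra). nra. }
  unfold Rdiv in *. rewrite Rmult_plus_distr_r in H2. lra.
Qed.

(** * Near-Fekete points and Cartan's lemma *)

Lemma rprod_nonneg (l : list R) (x : R) : 0 <= rprod l x.
Proof. rewrite <- Cmod_cprod_R. apply Cmod_ge_0. Qed.

Lemma rprod_permutation (l m : list R) (x : R) :
  Permutation l m -> rprod l x = rprod m x.
Proof. induction 1; simpl; try congruence. ring. Qed.

Fixpoint vandermonde (l : list R) : R :=
  match l with
  | nil => 1
  | a :: m => rprod m a * vandermonde m
  end.

Lemma vandermonde_permutation (l m : list R) :
  Permutation l m -> vandermonde l = vandermonde m.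
Proof.
  induction 1 as [|x l m H IH|x y l|l m n _ IH1 _ IH2]; simpl; try congruence.
  - now rewrite IH, (rprod_permutation l m).
  - rewrite (Rabs_minus_sym x y). ring.
Qed.

Lemma vandermonde_nonneg (l : list R) : 0 <= vandermonde l.
Proof.
  induction l as [|a l IH]; simpl; [lra|].
  apply Rmult_le_pos; [apply rprod_nonneg|easy].
Qed.

Lemma rprod_mem (l : list R) (a : R) : In a l -> rprod l a = 0.
Proof.
  intros H. rewrite <- Cmod_cprod_R, cprod_zero by easy. apply Cmod_0.
Qed.

Lemma vandermonde_NoDup (l : list R) : vandermonde l <> 0 -> NoDup l.
Proof.
  induction l as [|a l IH]; simpl; intros H; constructor.
  - intros Ha. apply H. rewrite rprod_mem by easy. ring.
  - apply IH. intros E. apply H. rewrite E. ring.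
Qed.

Lemma permutation_remove (l : list R) (a : R) :
  NoDup l -> In a l -> Permutation l (a :: remove Req_dec_T a l).
Proof.
  intros Hl Ha. apply NoDup_Permutation; [easy| |].
  - constructor.
    + intros H. apply in_remove in H. now apply H.
    + rewrite <- remove_alt. now apply NoDup_filter.
  - intros x. simpl. split.
    + intros Hx. destruct (Req_dec_T a x) as [->|Hne]; [now left|].
      right. apply in_in_remove; auto.
    + intros [<-|Hx]; [easy|]. now apply in_remove in Hx.
Qed.

Lemma vandermonde_bound (n : nat) :
  exists B, forall l, length l = n -> (forall b, In b l -> Rabs b <= 1) ->
    vandermonde l <= B.
Proof.
  induction n as [|n [B IH]].
  - exists 1. intros [|? ?]; simpl; [lra|easy].
  - exists (2 ^ n * B). intros [|a l] Hn Hb; [easy|]. injection Hn as Hn. simpl.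
    apply Rmult_le_compat; auto using rprod_nonneg, vandermonde_nonneg.
    + rewrite <- Cmod_cprod_R, <- Hn.
      apply (cprod_bounds l _ 0 2); [lra|]. intros b Hbl.
      split; [apply Cmod_ge_0|]. rewrite <- RtoC_minus, Cmod_R.
      assert (H1 := Hb a (or_introl eq_refl)). assert (H2 := Hb b (or_intror Hbl)).
      apply Rle_trans with (1 := Rabs_triang _ _). rewrite Rabs_Ropp. lra.
    + apply IH; [easy|]. intros b Hbl. apply Hb. now right.
Qed.

(* Points whose Vandermonde product is within a factor 2 of the supremum: moving
   one point to the good position of [x] gains at most that factor. *)
Lemma near_fekete_points (E : R -> Prop) (n : nat) (d : R) :
  0 < d -> (forall x, E x -> Rabs x <= 1) ->
  (forall l, (length l < n)%nat -> exists x, E x /\ d <= rprod l x) ->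
  exists l, length l = n /\ NoDup l /\ (forall b, In b l -> E b) /\
    forall b, In b l -> d / 2 <= rprod (remove Req_dec_T b l) b.
Proof.
  intros Hd HE Hgood.
  set (S := fun v => exists l, length l = n /\ (forall b, In b l -> E b) /\
                               v = vandermonde l).
  (* Adding good positions one at a time keeps the product positive, so the supremum is positive. *)
  assert (Hpos : exists v, S v /\ 0 < v).
  { assert (H : forall k, (k <= n)%nat -> exists l, length l = k /\
      (forall b, In b l -> E b) /\ 0 < vandermonde l).
    { induction k as [|k IH]; intros Hk.
      - exists nil. simpl. repeat split; [easy|lra].
      - destruct IH as [l [Hl [HlE Hv]]]; [lia|].
        destruct (Hgood l) as [x [Hx Hdx]]; [lia|].
        exists (x :: l). simpl. split; [now rewrite Hl|]. split.
        + intros b [<-|Hb]; auto.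
        + apply Rmult_lt_0_compat; lra. }
    destruct (H n (Nat.le_refl n)) as [l [Hl [HlE Hv]]].
    exists (vandermonde l). split; [now exists l|easy]. }
  destruct (completeness S) as [m [Hub Hlub]].
  { destruct (vandermonde_bound n) as [B HB]. exists B.
    intros v [l [Hl [HlE ->]]]. apply HB; auto. }
  { destruct Hpos as [v [Hv _]]. now exists v. }
  assert (Hm : 0 < m) by (destruct Hpos as [v [Hv Hv0]]; specialize (Hub v Hv); lra).
  assert (exists l, length l = n /\ (forall b, In b l -> E b) /\
                    m / 2 < vandermonde l) as [l [Hl [HlE Hv]]].
  { apply NNPP. intros Hno. assert (m <= m / 2); [|lra].
    apply Hlub. intros v [l [Hl [HlE ->]]]. apply Rnot_lt_le. intros Hlt.
    apply Hno. now exists l. }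
  assert (Hnd : NoDup l) by (apply vandermonde_NoDup; lra).
  exists l. repeat split; auto. intros b Hb.
  set (r := remove Req_dec_T b l).
  assert (Hperm := permutation_remove l b Hnd Hb). fold r in Hperm.
  assert (Hlen := Permutation_length Hperm). simpl in Hlen.
  destruct (Hgood r) as [x [Hx Hdx]]; [lia|].
  assert (Hvx : vandermonde (x :: r) <= m).
  { apply Hub. exists (x :: r). split; [simpl; lia|]. split; [|easy].
    intros c [<-|Hc]; [easy|]. apply HlE. now apply in_remove in Hc. }
  rewrite (vandermonde_permutation _ _ Hperm) in Hv. simpl in Hv, Hvx.
  assert (Hr : 0 < vandermonde r).
  { destruct (vandermonde_nonneg r) as [H|H]; [easy|]. rewrite <- H in Hv. lra. }
  assert (d * vandermonde r <= rprod r x * vandermonde r)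
    by (apply Rmult_le_compat_r; lra).
  apply Rmult_le_reg_r with (vandermonde r); [easy|]. lra.
Qed.

Definition near_count (x r : R) (l : list R) : nat :=
  length (filter (fun z => if Rlt_dec (Rabs (x - z)) r then true else false) l).

(** A pair (c, k) encodes an exceptional ball of centre c and order k. Its radius, 2 r_k, is left to
    the statements that use it. *)
Definition total_order (B : list (R * nat)) : nat :=
  fold_right (fun p s => (snd p + s)%nat) 0%nat B.

Lemma near_count_filter_le (x r : R) (p : R -> bool) (l : list R) :
  (near_count x r (filter p l) <= near_count x r l)%nat.
Proof.
  unfold near_count. induction l as [|a l IH]; simpl; [easy|].
  destruct (p a); simpl; destruct Rlt_dec; simpl; lia.
Qed.

(* Greedy: as long as some ball of radius r_K holds at least K points, discard
   them; when none does, decrease K. *)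
Lemma cartan (r : nat -> R) (l : list R) (K : nat) :
  (forall j k, (1 <= j <= k)%nat -> r j <= r k) ->
  (forall k x, (K < k)%nat -> (near_count x (r k) l < k)%nat) ->
  exists B : list (R * nat),
    (total_order B <= length l)%nat /\
    (forall c k, In (c, k) B -> (1 <= k)%nat) /\
    forall x, (forall c k, In (c, k) B -> 2 * r k <= Rabs (x - c)) ->
      forall k, (1 <= k)%nat -> (near_count x (r k) l < k)%nat.
Proof.
  intros Hr. remember (length l) as n eqn:Hn.
  revert n l Hn. induction K as [|K IHK]; intros n.
  { intros l Hn H. exists nil. simpl. repeat split; [lia|easy|].
    intros x _ k Hk. apply H. lia. }
  induction n as [n IHn] using (well_founded_induction Wf_nat.lt_wf).
  intros l Hn H.
  destruct (classic (exists x0, (S K <= near_count x0 (r (S K)) l)%nat))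
    as [[x0 Hx0]|Hno].
  - set (p := fun z => if Rlt_dec (Rabs (x0 - z)) (r (S K)) then true else false).
    set (l' := filter (fun z => negb (p z)) l).
    assert (Hlen : (near_count x0 (r (S K)) l + length l' = n)%nat)
      by (rewrite Hn; apply filter_length).
    destruct (IHn (length l') ltac:(lia) l' eq_refl) as [B [HB1 [HB2 HB3]]].
    { intros k x Hk. apply Nat.le_lt_trans with (near_count x (r k) l); [|auto].
      apply near_count_filter_le. }
    exists ((x0, S K) :: B). split; [simpl; lia|]. split.
    { intros c k [E|Hin]; [injection E; lia|eauto]. }
    intros x Hx k Hk.
    destruct (Nat.lt_ge_cases (S K) k) as [HkK|HkK]; [auto|].
    assert (Hfar := Hx x0 (S K) (or_introl eq_refl)).
    assert (Hrk := Hr k (S K) (conj Hk HkK)).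
    (* A discarded point within r_k of x would give |x - x0| < r_k + r_(K+1) <= 2 r_(K+1), inside
       the exceptional ball. *)
    assert (E : near_count x (r k) l = near_count x (r k) l').
    { unfold l', near_count. clear - Hfar Hrk. induction l as [|a l IH]; [easy|].
      cbn [filter]. destruct (Rlt_dec (Rabs (x - a)) (r k)) as [Ha|Ha].
      - assert (Hpa : p a = false).
        { unfold p. destruct Rlt_dec as [Ha'|]; [exfalso|easy].
          assert (T := Rabs_triang (x - a) (a - x0)).
          rewrite (Rabs_minus_sym a x0) in T.
          replace (x - a + (a - x0)) with (x - x0) in T by ring. lra. }
        rewrite Hpa. cbn [negb filter].
        destruct (Rlt_dec (Rabs (x - a)) (r k)); [|easy]. simpl. now rewrite IH.
      - destruct (negb (p a)); cbn [filter]; [|exact IH].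
        destruct (Rlt_dec (Rabs (x - a)) (r k)); [easy|exact IH]. }
    rewrite E. apply HB3; [|easy]. intros c j Hin. apply Hx. now right.
  - apply (IHK n l Hn). intros k x Hk.
    destruct (Nat.eq_dec k (S K)) as [->|Hne]; [|apply H; lia].
    apply Nat.nle_gt. intros Hc. apply Hno. now exists x.
Qed.

Lemma near_count_le_length (x r : R) (l : list R) :
  (near_count x r l <= length l)%nat.
Proof. apply filter_length_le. Qed.

Fixpoint radii_prod (r : nat -> R) (n : nat) : R :=
  match n with O => 1 | S m => r n * radii_prod r m end.

Lemma near_count_permutation (x r : R) (l m : list R) :
  Permutation l m -> near_count x r l = near_count x r m.
Proof.
  unfold near_count.
  induction 1; simpl; repeat destruct Rlt_dec; simpl; congruence.
Qed.

(** Of n points fewer than n lie within r_n of [x], so one is at distance at least r_n. It pays for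
    the factor r_n and is removed. *)
Lemma rprod_lower_bound (r : nat -> R) (l : list R) (x : R) :
  (forall k, 0 < r k) ->
  (forall k, (1 <= k)%nat -> (near_count x (r k) l < k)%nat) ->
  radii_prod r (length l) <= rprod l x.
Proof.
  intros Hr. remember (length l) as n eqn:Hn. revert l Hn.
  induction n as [|n IH]; intros l Hn H.
  - destruct l; [simpl; lra|easy].
  - assert (exists a, In a l /\ r (S n) <= Rabs (x - a)) as [a [Ha Hra]].
    { apply NNPP. intros Hno.
      assert (E : near_count x (r (S n)) l = length l).
      { assert (Hall : forall a, In a l -> Rabs (x - a) < r (S n)).
        { intros a Ha. apply Rnot_le_lt. intros Hle. apply Hno. now exists a. }
        clear - Hall. unfold near_count. induction l as [|a l IH]; [easy|].
        cbn [filter]. destruct Rlt_dec as [_|Hc].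
        - cbn [length]. rewrite IH; [easy|]. intros b Hb. apply Hall. now right.
        - exfalso. apply Hc, Hall. now left. }
      assert (H' := H (S n) ltac:(lia)). lia. }
    apply in_split in Ha. destruct Ha as [l1 [l2 ->]].
    assert (Hperm := Permutation_sym (Permutation_middle l1 l2 a)).
    rewrite (rprod_permutation _ _ _ Hperm). simpl.
    apply Rmult_le_compat; [left; apply Hr| |easy|].
    { clear - Hr. induction n; simpl; [lra|]. apply Rmult_le_pos; [left; apply Hr|easy]. }
    apply IH.
    + rewrite length_app in Hn |- *. simpl in Hn. lia.
    + intros k Hk. specialize (H k Hk).
      rewrite (near_count_permutation _ _ _ _ Hperm) in H.
      apply Nat.le_lt_trans with (2 := H).
      unfold near_count. simpl. destruct Rlt_dec; simpl; lia.
Qed.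

(** * Hausdorff content *)

Lemma gauge_small (f : R -> R) (eta : R) :
  gauge_function f -> 0 < eta -> exists t, 0 < t /\ f (2 * t) <= eta.
Proof.
  intros (Hpos & _ & _ & Hlim) Heta.
  destruct (Hlim (ball 0 (mkposreal eta Heta))) as [d Hd].
  { now exists (mkposreal eta Heta). }
  assert (Hd0 := cond_pos d). exists (d / 4). split; [lra|].
  assert (H : ball 0 eta (f (2 * (d / 4)))).
  { apply Hd; [|lra]. change (Rabs (2 * (d / 4) - 0) < d).
    rewrite Rabs_pos_eq; lra. }
  change (Rabs (f (2 * (d / 4)) - 0) < eta) in H.
  rewrite Rminus_0_r in H. left. apply Rle_lt_trans with (2 := H), Rle_abs.
Qed.

(** Supplies the tail that completes a finite cover to the infinite sequence required by
    [hausdorff_content]. *)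
Lemma gauge_small_series (f : R -> R) (eta : R) :
  gauge_function f -> 0 < eta ->
  exists r : nat -> R, (forall j, 0 < r j) /\
    exists s, is_series (fun j => f (2 * r j)) s /\ s <= eta.
Proof.
  intros Hf Heta.
  assert (H : forall j : nat, exists t, 0 < t /\ f (2 * t) <= eta / 2 * (1 / 2) ^ j).
  { intros j. apply gauge_small; [easy|].
    apply Rmult_lt_0_compat; [lra|apply pow_lt; lra]. }
  destruct (choice _ H) as [r Hr]. exists r. split; [apply Hr|].
  assert (Hgeom : is_series (fun j => eta / 2 * (1 / 2) ^ j) eta).
  { assert (E : eta / 2 * / (1 - 1 / 2) = eta) by field.
    apply (eq_ind _ (fun s => is_series (fun j => eta / 2 * (1 / 2) ^ j) s))
      with (2 := E).
    apply (is_series_scal_l (K := R_AbsRing) (eta / 2) (fun j => (1 / 2) ^ j)).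
    apply is_series_geom. rewrite Rabs_pos_eq; lra. }
  assert (Hle : forall j, 0 <= f (2 * r j) <= eta / 2 * (1 / 2) ^ j).
  { intros j. destruct (Hr j) as [H1 H2]. split; [|easy]. apply Hf. lra. }
  assert (Hex : ex_series (fun j => eta / 2 * (1 / 2) ^ j)) by now exists eta.
  exists (Series (fun j => f (2 * r j))). split.
  - apply Series_correct.
    apply (ex_series_le (K := R_AbsRing) (V := R_CompleteNormedModule)
      (fun j => f (2 * r j)) (fun j => eta / 2 * (1 / 2) ^ j)); [|easy].
    intros j. change (Rabs (f (2 * r j)) <= eta / 2 * (1 / 2) ^ j).
    rewrite Rabs_pos_eq; apply Hle.
  - rewrite <- (is_series_unique _ _ Hgeom). now apply Series_le.
Qed.

Definition cover_cost (f : R -> R) (B : list (R * R)) : R :=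
  fold_right (fun p s => f (2 * snd p) + s) 0 B.

Lemma hausdorff_content_finite_cover (f : R -> R) (E : R -> Prop)
    (B : list (R * R)) (eta : R) :
  gauge_function f -> 0 < eta -> (forall p, In p B -> 0 < snd p) ->
  (forall x, E x -> exists p, In p B /\ Rabs (x - fst p) < snd p) ->
  Rbar_le (hausdorff_content f E) (Finite (cover_cost f B + eta)).
Proof.
  intros Hf Heta HB HE.
  assert (H : exists c r : nat -> R, (forall j, 0 < r j) /\
    (forall p, In p B -> exists j, c j = fst p /\ r j = snd p) /\
    exists s, is_series (fun j => f (2 * r j)) s /\ s <= cover_cost f B + eta).
  { clear E HE. induction B as [|p B IH].
    - destruct (gauge_small_series f eta Hf Heta) as [r [Hr [s [Hs Hse]]]].
      exists (fun _ => 0), r. split; [easy|]. split; [easy|].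
      exists s. split; [easy|]. simpl. lra.
    - destruct IH as [c [r [Hr [Hc [s [Hs Hse]]]]]].
      { intros q Hq. apply HB. now right. }
      exists (fun j => match j with O => fst p | S j => c j end),
        (fun j => match j with O => snd p | S j => r j end).
      split; [|split].
      + intros [|j]; [apply HB; now left|apply Hr].
      + intros q [<-|Hq]; [now exists O|].
        destruct (Hc q Hq) as [j Hj]. now exists (S j).
      + exists (f (2 * snd p) + s). split; [|simpl; lra].
        apply (is_series_decr_1 (K := R_AbsRing) (V := R_NormedModule)).
        change (is_series (fun j => f (2 * r j))
          (f (2 * snd p) + s + - f (2 * snd p))).
        assert (Es : forall a b : R, b = a + b + - a) by (intros; ring).
        now rewrite <- Es. }
  destruct H as [c [r [Hr [Hc [s [Hs Hse]]]]]].
  apply Rbar_le_trans with (Finite s); [|exact Hse].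
  apply (Glb_Rbar_correct _). exists c, r. split; [easy|]. split; [|easy].
  intros x Hx. destruct (HE x Hx) as [p [Hp Hxp]].
  destruct (Hc p Hp) as [j [H1 H2]]. exists j.
  change (Rabs (x - c j) < r j). now rewrite H1, H2.
Qed.

(** An exceptional ball of order k has diameter 4 r_k and costs at most k c / (2 N). The orders sum
    to at most N, so all the balls cost at most c/2; if they covered [E], a tail of cost c/4 would
    bound the content by 3c/4. *)
Lemma hausdorff_content_avoid_clusters (f : R -> R) (E : R -> Prop) (c N : R)
    (r : nat -> R) (l : list R) :
  gauge_function f -> hausdorff_content f E = Finite c -> 0 < c -> 0 < N ->
  (forall k, 0 < r k) -> (forall j k, (1 <= j <= k)%nat -> r j <= r k) ->
  (forall k, (1 <= k)%nat -> f (4 * r k) <= INR k * (c / (2 * N))) ->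
  INR (length l) <= N ->
  exists x, E x /\ forall k, (1 <= k)%nat -> (near_count x (r k) l < k)%nat.
Proof.
  intros Hf Hc Hc0 HN Hr Hmono Hfr Hl. apply NNPP. intros Hno.
  destruct (cartan r l (length l) Hmono) as [B [HB1 [HB2 HB3]]].
  { intros k x Hk. apply Nat.le_lt_trans with (2 := Hk), near_count_le_length. }
  set (B' := map (fun p => (fst p, 2 * r (snd p))) B).
  assert (Hcost : cover_cost f B' <= INR (total_order B) * (c / (2 * N))).
  { clear - Hfr HB2. unfold B'. induction B as [|[x k] B IH]; simpl; [lra|].
    rewrite plus_INR, Rmult_plus_distr_r. apply Rplus_le_compat.
    - replace (2 * (2 * r k)) with (4 * r k) by ring.
      apply Hfr, (HB2 x). now left.
    - apply IH. intros y j Hj. apply (HB2 y). now right. }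
  assert (Hle := hausdorff_content_finite_cover f E B' (c / 4) Hf ltac:(lra)).
  rewrite Hc in Hle. simpl in Hle.
  assert (HcN : INR (total_order B) * (c / (2 * N)) <= N * (c / (2 * N))).
  { apply Rmult_le_compat_r.
    - apply Rdiv_le_0_compat; lra.
    - apply Rle_trans with (2 := Hl). now apply le_INR. }
  replace (N * (c / (2 * N))) with (c / 2) in HcN by (field; lra).
  enough (c <= cover_cost f B' + c / 4) by lra. apply Hle.
  - intros p Hp. apply in_map_iff in Hp. destruct Hp as [[x k] [<- _]].
    simpl. specialize (Hr k). lra.
  - intros x Hx. apply NNPP. intros Hfar. apply Hno. exists x. split; [easy|].
    apply HB3. intros y k Hin. apply Rnot_lt_le. intros Hlt. apply Hfar.
    exists (y, 2 * r k). split; [|easy].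
    apply in_map_iff. now exists (y, k).
Qed.

(* With [u = 2N / (kc)], the equation [h t = 1 / u] has a solution [log (1/t)] of order
   [u^2 (log u)^(-2 alpha)].  Here [log u] is replaced by [log (e + N)], and the
   square root keeps [log] of the exponent at least [log (e + N) / 2] for every
   [k]. *)
Definition cartan_exponent (alpha c : R) (N k : nat) : R :=
  3 * Rpower 4 alpha
  * ((2 * INR N / (INR k * c)) ^ 2
       * Rpower (ln (exp 1 + INR N)) (- (2 * alpha))
     + sqrt (exp 1 + INR N)).

(** With L the exponent, the added 2 gives 4 r_k < exp(-L), because 4 < e^2. *)
Definition cartan_radius (alpha c : R) (N k : nat) : R :=
  exp (- (cartan_exponent alpha c N k + 2)).

Lemma exp_le_mono (x y : R) : x <= y -> exp x <= exp y.
Proof. intros [H| ->]; [left; now apply exp_increasing|lra]. Qed.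

Lemma exp_1_ge_2 : 2 <= exp 1.
Proof. assert (H := exp_ineq1_le 1). lra. Qed.

Lemma ln_exp1_plus_ge_1 (x : R) : 0 <= x -> 1 <= ln (exp 1 + x).
Proof.
  intros Hx. rewrite <- (ln_exp 1) at 1. assert (H := exp_pos 1).
  apply ln_le; lra.
Qed.

Lemma Rpower_pos (x y : R) : 0 < Rpower x y.
Proof. apply exp_pos. Qed.

Lemma Rpower_4_ge_1 (alpha : R) : 0 < alpha -> 1 <= Rpower 4 alpha.
Proof.
  intros H. rewrite <- (Rpower_O 4) by lra. apply Rle_Rpower; lra.
Qed.

Lemma cartan_exponent_antitone (alpha c : R) (N j k : nat) :
  0 < c -> (1 <= j <= k)%nat ->
  cartan_exponent alpha c N k <= cartan_exponent alpha c N j.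
Proof.
  intros Hc [Hj Hjk]. apply le_INR in Hj, Hjk. simpl in Hj.
  unfold cartan_exponent.
  assert (H4 := Rpower_pos 4 alpha).
  apply Rmult_le_compat_l; [lra|]. apply Rplus_le_compat_r.
  apply Rmult_le_compat_r; [left; apply Rpower_pos|].
  assert (HN := pos_INR N).
  apply pow_incr. split.
  - apply Rdiv_le_0_compat; nra.
  - apply Rmult_le_compat_l; [lra|]. apply Rinv_le_contravar; nra.
Qed.

(** Three lower bounds on [L] are used, with b = kc / (2N) and lam = log (e + N). L >= 3 makes the
    formula for [h] valid at exp(-L). L >= 3 4^alpha b^(-2) lam^(-2 alpha) controls L^(-1/2). L >=
    sqrt (e + N) gives log L >= lam / 2, and the factor 2^alpha lost there is recovered from
    4^alpha. *)
Lemma h_cartan_radius (alpha : R) (h : R -> R) (c : R) (N k : nat) :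
  0 < alpha -> is_h alpha h -> 0 < c -> (1 <= N)%nat -> (1 <= k)%nat ->
  h (4 * cartan_radius alpha c N k) <= INR k * (c / (2 * INR N)).
Proof.
  intros Ha (Hg & Hh & _) Hc HN Hk.
  apply le_INR in HN, Hk. simpl in HN, Hk.
  set (L := cartan_exponent alpha c N k).
  assert (He := exp_1_ge_2).
  assert (H41 := Rpower_4_ge_1 alpha Ha).
  set (lam := ln (exp 1 + INR N)).
  assert (Hlam : 1 <= lam) by (apply ln_exp1_plus_ge_1; lra).
  set (b := INR k * (c / (2 * INR N))).
  assert (Hb : 0 < b) by (apply Rmult_lt_0_compat; [lra|apply Rdiv_lt_0_compat; lra]).
  assert (HL : L = 3 * Rpower 4 alpha * ((/ b) ^ 2 * Rpower lam (- (2 * alpha))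
                   + sqrt (exp 1 + INR N))).
  { unfold L, cartan_exponent, b, lam. do 4 f_equal. field. lra. }
  set (P := (/ b) ^ 2 * Rpower lam (- (2 * alpha))) in *.
  assert (HP : 0 < P).
  { apply Rmult_lt_0_compat; [|apply Rpower_pos].
    apply pow_lt, Rinv_0_lt_compat, Hb. }
  assert (Hs1 : 1 <= sqrt (exp 1 + INR N)).
  { rewrite <- sqrt_1 at 1. apply sqrt_le_1_alt. lra. }
  assert (HL3 : 3 <= L) by (rewrite HL; nra).
  assert (HL1 : 3 * Rpower 4 alpha * P <= L) by (rewrite HL; nra).
  assert (HL2 : sqrt (exp 1 + INR N) <= L) by (rewrite HL; nra).
  apply Rle_trans with (h (exp (- L))).
  { assert (E : 4 * cartan_radius alpha c N k < exp (- L)).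
    { unfold cartan_radius. fold L.
      replace (- (L + 2)) with (- L + - 2) by ring.
      rewrite exp_plus, exp_Ropp.
      assert (H4 : 4 < exp 2).
      (* The bound e >= 2 would give only 4 <= e^2; from e^(1/2) >= 3/2 the inequality is strict. *)
      { assert (H5 := exp_ineq1_le (1/2)).
        replace 2 with (1/2 + 1/2 + (1/2 + 1/2)) by field.
        rewrite !exp_plus.
        assert (1.5 * 1.5 <= exp (1/2) * exp (1/2))
          by (apply Rmult_le_compat; lra). nra. }
      replace (- 2) with (- (2)) by ring. rewrite (exp_Ropp 2).
      assert (HeL := exp_pos L).
      apply Rinv_0_lt_compat in HeL.
      assert (4 * / exp 2 < 1).
      { apply Rmult_lt_reg_r with (exp 2); [lra|].
        rewrite Rmult_assoc, Rinv_l by lra. lra. }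
      nra. }
    left. apply Hg; [|easy].
    apply Rmult_lt_0_compat; [lra|apply exp_pos]. }
  rewrite Hh.
  2: { split; [apply exp_pos|].
       destruct HL3 as [HL3| <-]; [left; apply exp_increasing; lra|].
       right. f_equal. }
  unfold h_formula.
  replace (1 / exp (- L)) with (exp L).
  2: { rewrite exp_Ropp. field. assert (H := exp_pos L). lra. }
  rewrite ln_exp. unfold Rpower at 1 2. rewrite <- exp_plus.
  rewrite <- (exp_ln b) by easy. apply exp_le_mono.
  assert (Hln1 : ln 3 + alpha * (2 * ln 2) - 2 * ln b - 2 * alpha * ln lam <= ln L).
  { apply Rle_trans with (ln (3 * Rpower 4 alpha * P)).
    - right. unfold P. rewrite !ln_mult; try apply Rpower_pos; try lra.
      + unfold Rpower. rewrite !ln_exp.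
        replace 4 with (2 * 2) by ring. rewrite (ln_mult 2 2) by lra.
        simpl. rewrite Rmult_1_r, ln_mult, ln_Rinv
          by (auto using Rinv_0_lt_compat). ring.
      + apply pow_lt, Rinv_0_lt_compat, Hb.
      + easy.
    - apply ln_le; [|easy]. apply Rmult_lt_0_compat; lra. }
  assert (Hln2 : ln lam - ln 2 <= ln (ln L)).
  { rewrite <- ln_div by lra. apply ln_le; [lra|].
    apply Rle_trans with (ln (sqrt (exp 1 + INR N))).
    - right. unfold lam. rewrite <- Rpower_sqrt by lra. unfold Rpower.
      rewrite ln_exp. field.
    - apply ln_le; lra. }
  assert (Hln3 : 0 <= ln 3) by (rewrite <- ln_1; apply ln_le; lra).
  assert (alpha * (ln lam - ln 2) <= alpha * ln (ln L))
    by (apply Rmult_le_compat_l; lra).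
  lra.
Qed.

(** The exponents add up. Their main terms are proportional to 1/k^2, and the induction uses that
    the sum of 1/k^2 over k <= n is at most 2 - 2/(n+1). *)
Lemma cartan_radii_prod (alpha c : R) (N n : nat) :
  0 < alpha -> 0 < c -> (n <= N)%nat ->
  exp (- (3 * Rpower 4 alpha * (2 * (2 * INR N / c) ^ 2
              * Rpower (ln (exp 1 + INR N)) (- (2 * alpha))
            + INR N * sqrt (exp 1 + INR N)) + 2 * INR N))
  <= radii_prod (cartan_radius alpha c N) n.
Proof.
  intros Ha Hc Hn.
  assert (H4 := Rpower_4_ge_1 alpha Ha).
  set (A := 3 * Rpower 4 alpha).
  set (w := Rpower (ln (exp 1 + INR N)) (- (2 * alpha))).
  assert (Hw : 0 < w) by apply Rpower_pos.
  set (q := sqrt (exp 1 + INR N)).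
  assert (Hq : 0 <= q) by apply sqrt_pos.
  set (T := (2 * INR N / c) ^ 2 * w).
  assert (HT : 0 <= T) by (apply Rmult_le_pos; [apply pow2_ge_0|lra]).
  assert (H : forall n, exp (- (A * (T * (2 - 2 / (INR n + 1)) + INR n * q) + 2 * INR n))
              <= radii_prod (cartan_radius alpha c N) n).
  { clear n Hn. induction n as [|n IH].
    - simpl. right. transitivity (exp 0); [f_equal; field|apply exp_0].
    - cbn [radii_prod]. unfold cartan_radius at 1.
      apply Rle_trans with (exp (- (cartan_exponent alpha c N (S n) + 2))
        * exp (- (A * (T * (2 - 2 / (INR n + 1)) + INR n * q) + 2 * INR n))).
      2: { apply Rmult_le_compat_l; [left; apply exp_pos|easy]. }
      rewrite <- exp_plus. apply exp_le_mono.
      rewrite S_INR. assert (Hn0 := pos_INR n).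
      assert (E : cartan_exponent alpha c N (S n)
                  = A * (T * (/ (INR n + 1)) ^ 2 + q)).
      { unfold cartan_exponent, T. rewrite S_INR. fold A w q. field. lra. }
      rewrite E.
      assert (Hk : (/ (INR n + 1)) ^ 2 <= 2 / (INR n + 1) - 2 / (INR n + 1 + 1)).
      { apply Rle_trans with (/ (INR n + 1) * (2 / (INR n + 1 + 1))).
        - simpl. rewrite Rmult_1_r. apply Rmult_le_compat_l.
          + left. apply Rinv_0_lt_compat. lra.
          + apply Rmult_le_reg_r with ((INR n + 1) * (INR n + 1 + 1)); [nra|].
            replace (/ (INR n + 1) * ((INR n + 1) * (INR n + 1 + 1)))
              with (INR n + 1 + 1) by (field; lra).
            replace (2 / (INR n + 1 + 1) * ((INR n + 1) * (INR n + 1 + 1)))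
              with (2 * (INR n + 1)) by (field; lra). lra.
        - right. field. lra. }
      assert (T * (/ (INR n + 1)) ^ 2 <= T * (2 / (INR n + 1) - 2 / (INR n + 1 + 1)))
        by now apply Rmult_le_compat_l.
      assert (HA : 0 < A) by (unfold A; lra).
      nra. }
  apply Rle_trans with (2 := H n). apply exp_le_mono.
  apply le_INR in Hn. assert (Hn0 := pos_INR n).
  assert (HA : 0 < A) by (unfold A; lra).
  assert (0 < 2 / (INR n + 1)) by (apply Rdiv_lt_0_compat; lra).
  assert (T * (2 - 2 / (INR n + 1)) <= T * 2) by (apply Rmult_le_compat_l; lra).
  assert (INR n * q <= INR N * q) by now apply Rmult_le_compat_r.
  assert (A * (T * (2 - 2 / (INR n + 1)) + INR n * q) <= A * (T * 2 + INR N * q))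
    by (apply Rmult_le_compat_l; lra).
  replace (2 * (2 * INR N / c) ^ 2 * w) with (T * 2) by (unfold T; ring).
  lra.
Qed.

(** * Estimates of the exponent *)

(** From log (a y) <= a y - 1 at y = log (m + e): the choice a = 1 / (2 beta) turns beta log y into
    y/2 plus a constant, and y <= log 4 + log m. *)
Lemma log_power_le_sqrt (beta : R) : 0 < beta ->
  exists D, 0 < D /\ forall m, 1 <= m ->
    1 <= D * (sqrt m * Rpower (ln (m + exp 1)) (- beta)).
Proof.
  intros Hb. set (a := / (2 * beta)).
  assert (Ha : 0 < a) by (apply Rinv_0_lt_compat; lra).
  exists (exp (ln 4 / 2 - beta * ln a)). split; [apply exp_pos|]. intros m Hm.
  assert (He := exp_1_ge_2). assert (He3 := exp_le_3).
  rewrite <- Rpower_sqrt by lra. unfold Rpower. rewrite <- !exp_plus.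
  rewrite <- exp_0 at 1. apply exp_le_mono.
  set (y := ln (m + exp 1)).
  assert (Hy1 : 1 <= y).
  { unfold y. rewrite Rplus_comm. apply ln_exp1_plus_ge_1. lra. }
  assert (Hy : y <= ln 4 + ln m).
  { rewrite <- ln_mult by lra. apply ln_le; lra. }
  assert (Hly : ln a + ln y <= a * y - 1).
  { rewrite <- ln_mult by lra. assert (Hay : 0 < a * y) by nra.
    assert (H := exp_ineq1_le (ln (a * y))). rewrite exp_ln in H by easy. lra. }
  apply (Rmult_le_compat_l beta) in Hly; [|lra].
  assert (E : beta * (a * y - 1) = y / 2 - beta) by (unfold a; field; lra).
  rewrite E in Hly. lra.
Qed.

(** The quadratic term has the logarithm to the power -2 alpha, which is at most its power -2 alpha
    / 3. The other terms are O(m^(3/2)), absorbed into m^2 times that power by [log_power_le_sqrt];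
    c <= 2 supplies 1 <= 4 / c^2. *)
Lemma exponent_estimate (alpha : R) : 0 < alpha ->
  exists K, 0 < K /\ forall m n c, 1 <= m -> m + 1 <= n <= 3 * m -> 0 < c <= 2 ->
    3 * Rpower 4 alpha * (2 * (2 * n / c) ^ 2
        * Rpower (ln (exp 1 + n)) (- (2 * alpha))
      + n * sqrt (exp 1 + n)) + 9 * n
    <= K * m ^ 2 * Rpower (ln (m + exp 1)) (- (2 * alpha / 3)) / c ^ 2.
Proof.
  intros Ha.
  destruct (log_power_le_sqrt (2 * alpha / 3)) as [D [HD HDm]]; [lra|].
  set (A := 3 * Rpower 4 alpha).
  assert (HA : 0 < A) by (assert (H := Rpower_pos 4 alpha); unfold A; lra).
  (* 72 = 8 * 3^2 from n <= 3 m; 9 A and 27 bound the two lower terms by multiples of m^(3/2), and 4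
     D absorbs that power. *)
  exists (72 * A + 4 * (9 * A + 27) * D). split; [nra|].
  intros m n c Hm [Hn1 Hn2] [Hc0 Hc2].
  assert (He := exp_1_ge_2). assert (He3 := exp_le_3).
  specialize (HDm m Hm).
  set (q := Rpower (ln (m + exp 1)) (- (2 * alpha / 3))) in *.
  set (w := Rpower (ln (exp 1 + n)) (- (2 * alpha))).
  assert (Hq0 : 0 < q) by apply Rpower_pos.
  assert (Hw0 : 0 < w) by apply Rpower_pos.
  assert (Hwq : w <= q).
  { unfold w, q, Rpower. apply exp_le_mono.
    assert (H1 : 1 <= ln (m + exp 1)).
    { rewrite Rplus_comm. apply ln_exp1_plus_ge_1. lra. }
    assert (H2 : ln (ln (m + exp 1)) <= ln (ln (exp 1 + n))).
    { apply ln_le; [lra|]. apply ln_le; lra. }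
    assert (H3 : 0 <= ln (ln (m + exp 1))) by (rewrite <- ln_1; apply ln_le; lra).
    assert (alpha * ln (ln (m + exp 1)) <= alpha * ln (ln (exp 1 + n)))
      by (apply Rmult_le_compat_l; lra).
    assert (0 <= alpha * ln (ln (m + exp 1))) by (apply Rmult_le_pos; lra).
    lra. }
  set (u := / c ^ 2).
  assert (Hc2pos : 0 < c ^ 2) by (apply pow_lt; lra).
  assert (Hu : 1 <= 4 * u).
  { apply Rmult_le_reg_r with (c ^ 2); [easy|]. unfold u.
    rewrite Rmult_assoc, Rinv_l by lra. nra. }
  set (s := sqrt m) in *.
  assert (Hs1 : 1 <= s) by (unfold s; rewrite <- sqrt_1 at 1; now apply sqrt_le_1_alt).
  assert (Hss : s * s = m) by (apply sqrt_sqrt; lra).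
  assert (Hsn : sqrt (exp 1 + n) <= 3 * s).
  { apply Rsqr_incr_0_var; [|lra]. rewrite Rsqr_sqrt by lra. unfold Rsqr. nra. }
  replace (2 * (2 * n / c) ^ 2 * w) with (8 * u * (n ^ 2 * w))
    by (unfold u; field; lra).
  assert (H1 : n ^ 2 * w <= (3 * m) ^ 2 * q).
  { apply Rmult_le_compat; [apply pow2_ge_0|lra| |easy]. apply pow_incr. lra. }
  assert (H2 : n * sqrt (exp 1 + n) <= 3 * m * (3 * s)).
  { apply Rmult_le_compat; try lra. apply sqrt_pos. }
  assert (H3 : m * s <= D * (m ^ 2 * q)).
  { replace (D * (m ^ 2 * q)) with (m * s * (D * (s * q)))
      by (rewrite <- Hss; ring).
    rewrite <- (Rmult_1_r (m * s)) at 1. apply Rmult_le_compat_l; [nra|easy]. }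
  assert (H4 : 9 * n <= 27 * (m * s)) by nra.
  replace ((72 * A + 4 * (9 * A + 27) * D) * m ^ 2 * q / c ^ 2)
    with (A * (8 * u * ((3 * m) ^ 2 * q)) + (9 * A + 27) * (4 * u * (D * (m ^ 2 * q))))
    by (unfold u; field; lra).
  assert (H5 : 8 * u * (n ^ 2 * w) <= 8 * u * ((3 * m) ^ 2 * q))
    by (apply Rmult_le_compat_l; lra).
  assert (H6 : m * s <= 4 * u * (D * (m ^ 2 * q))).
  { apply Rle_trans with (1 * (m * s)); [lra|]. apply Rmult_le_compat; nra. }
  apply (Rmult_le_compat_l A) in H5; [|lra].
  apply (Rmult_le_compat_l A) in H2; [|lra].
  apply (Rmult_le_compat_l (9 * A + 27)) in H6; [|lra].
  lra.
Qed.

(** * Suprema, bounds on the content, and the conclusion *)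

Lemma sup_on_le {T : Type} (A : T -> Prop) (g : T -> R) (b : R) :
  (exists x, A x) -> (forall x, A x -> g x <= b) -> sup_on A g <= b.
Proof.
  intros [x Hx] Hb. unfold sup_on.
  destruct (Lub_Rbar_correct (fun y => exists x, A x /\ y = g x)) as [H1 H2].
  specialize (H1 (g x) (ex_intro _ x (conj Hx eq_refl))).
  specialize (H2 (Finite b)).
  assert (H3 : Rbar_le (Lub_Rbar (fun y => exists x, A x /\ y = g x)) b).
  { apply H2. intros y [z [Hz ->]]. now apply Hb. }
  now destruct Lub_Rbar.
Qed.

(** The point [x] and the bound [b] keep the least upper bound finite, so [real] does not fall back
    on 0. *)
Lemma sup_on_ge {T : Type} (A : T -> Prop) (g : T -> R) (b : R) (x : T) :
  A x -> (forall x, A x -> g x <= b) -> g x <= sup_on A g.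
Proof.
  intros Hx Hb. unfold sup_on.
  destruct (Lub_Rbar_correct (fun y => exists x, A x /\ y = g x)) as [H1 H2].
  specialize (H1 (g x) (ex_intro _ x (conj Hx eq_refl))).
  specialize (H2 (Finite b)).
  assert (H3 : Rbar_le (Lub_Rbar (fun y => exists x, A x /\ y = g x)) b).
  { apply H2. intros y [z [Hz ->]]. now apply Hb. }
  now destruct Lub_Rbar.
Qed.

Lemma interval_length_bound (I : R -> Prop) (l x y : R) :
  interval_length I = Finite l -> l <> 0 -> I x -> I y -> Rabs (x - y) <= l.
Proof.
  unfold interval_length. intros Hl Hl0 Hx Hy.
  destruct (Lub_Rbar_correct I) as [H1 _].
  destruct (Glb_Rbar_correct I) as [H2 _].
  assert (A1 := H1 x Hx). assert (A2 := H1 y Hy).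
  assert (A3 := H2 x Hx). assert (A4 := H2 y Hy).
  destruct (Lub_Rbar I) as [u| |], (Glb_Rbar I) as [v| |]; simpl in *;
    try discriminate; try easy.
  injection Hl as Hl. apply Rabs_le_between. lra.
Qed.

Lemma h_lt_1 (alpha : R) (h : R -> R) (t : R) : is_h alpha h -> 0 < t -> h t < 1.
Proof.
  intros ((_ & Hinc & _) & _ & Hlim) Ht.
  apply Rlt_le_trans with (h (t + 1)); [apply Hinc; lra|].
  apply Rnot_lt_le. intros H.
  assert (Hd : 0 < h (t + 1) - 1) by lra.
  apply is_lim_spec in Hlim.
  destruct (Hlim (mkposreal _ Hd)) as [m Hm]. simpl in Hm.
  set (x := Rmax (m + 1) (t + 2)).
  assert (Hx1 := Rmax_l (m + 1) (t + 2)). assert (Hx2 := Rmax_r (m + 1) (t + 2)).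
  fold x in Hx1, Hx2.
  specialize (Hm x ltac:(lra)). apply Rabs_lt_between in Hm.
  assert (h (t + 1) < h x) by (apply Hinc; lra). lra.
Qed.

(** Makes the content finite and provides the c <= 2 of [exponent_estimate]. One ball costs less
    than 1 since [h] increases strictly to 1, and the tail costs at most 1. *)
Lemma content_le_2 (alpha : R) (h : R -> R) (E : R -> Prop) :
  is_h alpha h -> (forall x, E x -> Rabs x <= 1) ->
  Rbar_le (hausdorff_content h E) (Finite 2).
Proof.
  intros Hh HE.
  apply Rbar_le_trans with (Finite (cover_cost h ((0, 2) :: nil) + 1)).
  - apply hausdorff_content_finite_cover; [apply Hh|lra| |].
    + intros p [<-|[]]. simpl. lra.
    + intros x Hx. exists (0, 2). split; [now left|]. simpl.
      specialize (HE x Hx). rewrite Rminus_0_r. lra.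
  - simpl. assert (H := h_lt_1 alpha h (2 * 2) Hh ltac:(lra)). lra.
Qed.

Lemma content_pos_nonempty (f : R -> R) (E : R -> Prop) :
  gauge_function f -> Rbar_lt 0 (hausdorff_content f E) -> exists x, E x.
Proof.
  intros Hf Hc. apply NNPP. intros Hno.
  assert (Hle : forall eta, 0 < eta -> Rbar_le (hausdorff_content f E) (Finite eta)).
  { intros eta Heta. replace eta with (cover_cost f nil + eta) by (simpl; ring).
    apply hausdorff_content_finite_cover; try easy.
    intros x Hx. exfalso. apply Hno. now exists x. }
  destruct (hausdorff_content f E) as [c| |]; simpl in *.
  - specialize (Hle (c / 2)). lra.
  - now apply (Hle 1), Rlt_0_1.
  - easy.
Qed.

(** As 2 M <= 3^N, the term M / 3^N of the interpolation bound is at most 1/2, so the interpolant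
    accounts for the other half: 1 <= 8 N 5^N s / d. *)
Lemma lower_bound_large_max (alpha c M s : R) (h : R -> R) (E : R -> Prop)
    (f : C -> C) (N : nat) :
  0 < alpha -> is_h alpha h -> hausdorff_content h E = Finite c -> 0 < c ->
  (forall x, E x -> Rabs x <= 1) ->
  (forall n w, disk 4 w -> taylor_order n w f) ->
  (forall w, disk 4 w -> Cmod (f w) <= M) -> 1 <= Cmod (f (RtoC 0)) ->
  (forall x, E x -> Cmod (f (RtoC x)) <= s) -> 0 <= s ->
  (1 <= N)%nat -> 2 * M <= 3 ^ N ->
  1 <= exp (3 * Rpower 4 alpha * (2 * (2 * INR N / c) ^ 2
              * Rpower (ln (exp 1 + INR N)) (- (2 * alpha))
            + INR N * sqrt (exp 1 + INR N)) + 9 * INR N) * s.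
Proof.
  intros Ha Hh Hc Hc0 HE Hf HM H0 Hs Hs0 HN H3N.
  set (X := 3 * Rpower 4 alpha * (2 * (2 * INR N / c) ^ 2
              * Rpower (ln (exp 1 + INR N)) (- (2 * alpha))
            + INR N * sqrt (exp 1 + INR N))).
  assert (HN1 : 1 <= INR N) by now apply (le_INR 1).
  set (d := exp (- (X + 2 * INR N))).
  assert (Hd : 0 < d) by apply exp_pos.
  destruct (near_fekete_points E N d Hd HE) as [l [Hl [Hnd [HlE Hprod]]]].
  { intros l Hl.
    destruct (hausdorff_content_avoid_clusters h E c (INR N)
      (cartan_radius alpha c N) l) as [x [Hx Hfar]]; try easy.
    - apply Hh.
    - lra.
    - intros k. apply exp_pos.
    - intros j k Hjk. apply exp_le_mono, Ropp_le_contravar, Rplus_le_compat_r.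
      now apply cartan_exponent_antitone.
    - intros k Hk. now apply h_cartan_radius.
    - apply le_INR. lia.
    - exists x. split; [easy|].
      apply Rle_trans with (radii_prod (cartan_radius alpha c N) (length l)).
      + apply cartan_radii_prod; try easy. lia.
      + apply rprod_lower_bound; [|easy]. intros k. apply exp_pos. }
  assert (Hint := interpolation_bound f l M s (d / 2) Hf HM Hnd
    (fun b Hb => HE b (HlE b Hb)) ltac:(lra) Hs0
    (fun b Hb => conj (Hs b (HlE b Hb)) (Hprod b Hb))).
  rewrite Hl in Hint.
  assert (H3 : 0 < 3 ^ N) by (apply pow_lt; lra).
  assert (Hhalf : M / 3 ^ N <= 1 / 2).
  { apply Rmult_le_reg_r with (3 ^ N); [easy|].
    unfold Rdiv at 1. rewrite Rmult_assoc, Rinv_l by lra. lra. }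
  (* The factors are at most e^N, e^(3N) and e^(3N); with the 2N in [d] this makes the 9N of the
     statement. *)
  assert (Hexp : INR N * 5 ^ N * 8 <= exp (7 * INR N)).
  { assert (He := exp_1_ge_2).
    assert (He3 : 8 <= exp 3).
    { replace 3 with (1 + 1 + 1) by ring. rewrite !exp_plus. nra. }
    assert (He3N : 5 ^ N <= exp (3 * INR N)).
    { rewrite Rmult_comm. rewrite <- (Rpower_pow N 5) by lra. unfold Rpower.
      apply exp_le_mono, Rmult_le_compat_l; [lra|].
      rewrite <- (ln_exp 3). apply ln_le; lra. }
    assert (HeN : INR N <= exp (INR N)) by (assert (H := exp_ineq1_le (INR N)); lra).
    assert (He8 : 8 <= exp (3 * INR N)).
    { apply Rle_trans with (1 := He3), exp_le_mono. lra. }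
    replace (7 * INR N) with (INR N + 3 * INR N + 3 * INR N) by ring.
    rewrite !exp_plus.
    assert (0 <= 5 ^ N) by (apply pow_le; lra).
    apply Rmult_le_compat; try lra; [apply Rmult_le_pos; lra|].
    apply Rmult_le_compat; lra. }
  assert (Hfin : 1 <= INR N * 5 ^ N * 8 * (/ d * s)).
  { replace (INR N * 5 ^ N * 8 * (/ d * s))
      with (2 * (2 * (INR N * (s * (5 ^ N / (d / 2)))))) by (field; lra).
    lra. }
  apply Rle_trans with (1 := Hfin).
  replace (X + 9 * INR N) with (7 * INR N + (X + 2 * INR N)) by ring.
  rewrite exp_plus, (Rmult_assoc (exp _) (exp _) s).
  assert (Ed : / d = exp (X + 2 * INR N)).
  { unfold d. now rewrite exp_Ropp, Rinv_inv. }
  rewrite Ed. apply Rmult_le_compat_r; [|easy].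
  apply Rmult_le_pos; [left; apply exp_pos|easy].
Qed.

Theorem lemma3p11 (alpha : R) (alpha_pos : 0 < alpha) :
  exists K : R, 0 < K /\
  forall (h : R -> R), is_h alpha h ->
  forall (I : R -> Prop),
    is_interval I -> interval_length I = Finite 1 -> I 0 ->
  forall (phi : C -> C),
    analytic_on (disk 5) phi -> 1 <= Cmod (phi (RtoC 0)) ->
  forall (E : R -> Prop),
    (forall x, E x -> I x) -> Rbar_lt 0 (hausdorff_content h E) ->
  let M := sup_on (disk 4) (fun z => Cmod (phi z)) in
  sup_on I (fun x => Cmod (phi (RtoC x)))
  <= M ^ 9
     * exp (K * (ln M) ^ 2
              * Rpower (ln (ln M / ln 2 + exp 1)) (- (2 * alpha / 3))
            / (real (hausdorff_content h E)) ^ 2)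
     * sup_on E (fun x => Cmod (phi (RtoC x))).
Proof.
  destruct (exponent_estimate alpha alpha_pos) as [K [HK Hest]].
  assert (Hln2 : 0 < ln 2) by (rewrite <- ln_1; apply ln_increasing; lra).
  (* [exponent_estimate] is stated in m = log M / log 2, hence the division. *)
  exists (K / ln 2 ^ 2). split.
  { apply Rdiv_lt_0_compat; [easy|]. now apply pow_lt. }
  intros h Hh I _ Hlen I0 f Hf H0 E HEI Hcont M.
  assert (HI : forall x, I x -> Rabs x <= 1).
  { intros x Hx. rewrite <- (Rminus_0_r x).
    now apply (interval_length_bound I); auto. }
  assert (HE : forall x, E x -> Rabs x <= 1) by auto.
  assert (Htaylor : forall n w, disk 4 w -> taylor_order n w f).
  { intros n w Hw. apply analytic_taylor_order with (disk 5); [easy|].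
    unfold disk in *. lra. }
  assert (D0 : disk 4 (RtoC 0)) by (unfold disk; rewrite Cmod_0; lra).
  (* The attained maximum bounds |f| on the disk, so [M] is a true supremum. *)
  destruct (usc_attains_max_on_disk 4 (fun z => Cmod (f z))) as [p [Hp Hmax]];
    [lra| |].
  { intros z Hz eps Heps.
    destruct (taylor_order_1_continuous z f (Htaylor _ z Hz) eps Heps)
      as [d [Hd Hcts]].
    exists d. split; [easy|]. intros w Hw. specialize (Hcts w Hw).
    assert (H := Cmod_triangle_rev (f w) (f z)). lra. }
  assert (HM : forall w, disk 4 w -> Cmod (f w) <= M).
  { intros w Hw. now apply (sup_on_ge (disk 4) (fun z => Cmod (f z)) (Cmod (f p))). }
  assert (DR : forall x, Rabs x <= 1 -> disk 4 (RtoC x))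
    by (intros x Hx; unfold disk; rewrite Cmod_R; lra).
  assert (HsupI : sup_on I (fun x => Cmod (f (RtoC x))) <= M).
  { apply sup_on_le; [now exists 0|]. auto. }
  set (s := sup_on E (fun x => Cmod (f (RtoC x)))).
  assert (Hs : forall x, E x -> Cmod (f (RtoC x)) <= s).
  { intros x Hx. apply (sup_on_ge E (fun x => Cmod (f (RtoC x))) M); auto. }
  destruct (content_pos_nonempty h E) as [x0 Hx0]; [apply Hh|easy|].
  assert (Hs0 : 0 <= s) by (apply Rle_trans with (2 := Hs x0 Hx0), Cmod_ge_0).
  assert (HM1 : 1 <= M) by (apply Rle_trans with (1 := H0); auto).
  apply Rle_trans with (1 := HsupI).
  assert (Hc2 := content_le_2 alpha h E Hh HE).
  destruct (hausdorff_content h E) as [c| |] eqn:Hc; try easy.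
  simpl in Hcont, Hc2. simpl real.
  set (m := ln M / ln 2).
  assert (HlnM : 0 <= ln M) by (rewrite <- ln_1; apply ln_le; lra).
  replace (K / ln 2 ^ 2 * ln M ^ 2 * Rpower (ln (m + exp 1)) (- (2 * alpha / 3))
           / c ^ 2)
    with (K * m ^ 2 * Rpower (ln (m + exp 1)) (- (2 * alpha / 3)) / c ^ 2)
    by (unfold m; field; lra).
  set (X := K * m ^ 2 * Rpower (ln (m + exp 1)) (- (2 * alpha / 3)) / c ^ 2).
  assert (HM9 : 1 <= M ^ 9) by (apply pow_R1_Rle; lra).
  destruct (Rle_dec M 2) as [HM2|HM2].
  (* For M <= 2 a single point of [E] suffices, and the exponential is only bounded below by 1. *)
  - assert (HX : 1 <= exp X).
    { rewrite <- exp_0 at 1. apply exp_le_mono. unfold X.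
      apply Rdiv_le_0_compat; [|apply pow_lt; lra].
      apply Rmult_le_pos; [|left; apply Rpower_pos].
      apply Rmult_le_pos; [lra|apply pow2_ge_0]. }
    apply Rle_trans with (M ^ 9 * Cmod (f (RtoC x0))).
    + apply lower_bound_small_max; auto.
      unfold disk. rewrite Cmod_R. auto.
    + apply Rmult_le_compat; [lra|apply Cmod_ge_0| |auto]. nra.
  - assert (Hm : 1 <= m).
    { unfold m. apply Rmult_le_reg_r with (ln 2); [easy|].
      unfold Rdiv. rewrite Rmult_assoc, Rinv_l, Rmult_1_l, Rmult_1_r by lra.
      apply ln_le; lra. }
    (* N = k + 2 satisfies m + 1 <= N <= m + 2 <= 3 m, and 2 M = 2^(m+1) <= 2^N <= 3^N. *)
    destruct (nfloor_ex m) as [k [Hk1 Hk2]]; [lra|].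
    assert (HN : INR (k + 2) = INR k + 2) by (rewrite plus_INR; reflexivity).
    assert (H3N : 2 * M <= 3 ^ (k + 2)).
    { apply Rle_trans with (2 ^ (k + 2)); [|apply pow_incr; lra].
      rewrite <- Rpower_pow by lra. unfold Rpower.
      apply Rle_trans with (exp ((m + 1) * ln 2)).
      - rewrite Rmult_plus_distr_r, exp_plus, Rmult_1_l.
        replace (m * ln 2) with (ln M) by (unfold m; field; lra).
        rewrite !exp_ln by lra. lra.
      - apply exp_le_mono, Rmult_le_compat_r; lra. }
    assert (Hk0 : (1 <= k + 2)%nat) by lia.
    assert (Hlow := lower_bound_large_max alpha c M s h E f (k + 2) alpha_pos Hh Hc
      Hcont HE Htaylor HM H0 Hs Hs0 Hk0 H3N).
    assert (Hx := Hest m (INR (k + 2)) c Hm ltac:(lra) (conj Hcont Hc2)).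
    fold X in Hx. apply exp_le_mono in Hx.
    assert (HXs : 1 <= exp X * s).
    { apply Rle_trans with (1 := Hlow). now apply Rmult_le_compat_r. }
    assert (HMM : M <= M ^ 9).
    { rewrite <- (pow_1 M) at 1. apply Rle_pow; [lra|lia]. }
    rewrite Rmult_assoc. nra.
Qed.
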